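(* If $\emptyset\vdash_{\mathbf c}M:A$ and $M\Downarrow_{\mathbf c}V$ in the polymorphic RPC calculus, then $\langle\mathcal C[\![M]\!]_{\emptyset,\mathbf c,A}\mid\epsilon\rangle\longrightarrow^*\langle\mathcal C[\![V]\!]_{\emptyset,\mathbf c,A}\mid\epsilon\rangle$ in the polymorphic client-server calculus, where reduction is with respect to the function maps generated by the slicing compilation.
   Context: Location constants $a,b::=\mathbf c\mid\mathbf s$ (client, server); $Loc::=a\mid l$ with $l$ a location variable. $\{\cdot/\cdot\}$ is capture-avoiding substitution. **Polymorphic RPC calculus (source).** Types $A,B,C::=base\mid A\xrightarrow{Loc}B\mid\alpha\mid A\times B\mid\forall\alpha.A\mid\forall l.A$. Terms $L,M,N::=V\mid L\,M\mid M[A]\mid M[Loc]\mid(L,M)\mid\pi_i(M)$; values $V,W::=x\mid\lambda^{Loc}x.M\mid\Lambda\alpha.V\mid\Lambda l.V\mid(V,W)$. Environments $\Gamma$: finite lists of $x:A$, $\alpha$, $l$. Typing $\Gamma\vdash_{Loc}M:A$: - $\Gamma\vdash_{Loc}x:A$ if $\Gamma(x)=A$. - $\Gamma,x:A\vdash_{Loc}M:B$ gives $\Gamma\vdash_{Loc'}\lambda^{Loc}x.M:A\xrightarrow{Loc}B$. - $\Gamma\vdash_{Loc}L:A\xrightarrow{Loc'}B$ and $\Gamma\vdash_{Loc}M:A$ give $\Gamma\vdash_{Loc}L\,M:B$. - $\Gamma,\alpha\vdash_{Loc}V:A$ gives $\Gamma\vdash_{Loc}\Lambda\alpha.V:\forall\alpha.A$;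 $\Gamma\vdash_{Loc}M:\forall\alpha.A$ gives $\Gamma\vdash_{Loc}M[B]:A\{B/\alpha\}$. - $\Gamma,l\vdash_{Loc}V:A$ gives $\Gamma\vdash_{Loc}\Lambda l.V:\forall l.A$ (bound $l$ not occurring in $\Gamma$ or $Loc$); $\Gamma\vdash_{Loc}M:\forall l.A$ gives $\Gamma\vdash_{Loc}M[Loc']:A\{Loc'/l\}$. - $\Gamma\vdash_{Loc}L:A$, $\Gamma\vdash_{Loc}M:B$ give $\Gamma\vdash_{Loc}(L,M):A\times B$; $\Gamma\vdash_{Loc}M:A_1\times A_2$ gives $\Gamma\vdash_{Loc}\pi_i(M):A_i$, $i\in\{1,2\}$. Big-step evaluation $M\Downarrow_aV$ (''$M$ evaluates to $V$ at location $a$''): - $\lambda^bx.M\Downarrow_a\lambda^bx.M$; $\Lambda\alpha.V\Downarrow_a\Lambda\alpha.V$; $\Lambda l.V\Downarrow_a\Lambda l.V$. - $L\Downarrow_a\lambda^bx.N$, $M\Downarrow_aW$, $N\{W/x\}\Downarrow_bV$ give $L\,M\Downarrow_aV$. - $M\Downarrow_a\Lambda\alpha.V$ gives $M[B]\Downarrow_aV\{B/\alpha\}$; $M\Downarrow_a\Lambda l.V$ gives $M[b]\Downarrow_aV\{b/l\}$. - $L\Downarrow_aV$, $M\Downarrow_aW$ give $(L,M)\Downarrow_a(V,W)$; $M\Downarrow_a(V_1,V_2)$ gives $\pi_i(M)\Downarrow_aV_i$. **Polymorphic client-server calculus (target).** Types $A::=base\mid A\xrightarrow{Loc}B\mid Clo(A)\mid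 A\times B\mid\alpha\mid\forall\alpha.A\mid\forall l.A\mid T\,A$. Values $V,W::=x\mid(V,W)\mid clo(\overline W,F)\mid\Lambda\alpha.V\mid\mathsf{unit}\,V\mid\mathsf{do}\,x\leftarrow M\,\mathsf{in}\,N\mid\mathsf{req}(V,W)\mid\mathsf{call}(V,W)\mid\mathsf{gen}(Loc,V,W)$. Terms $M,N::=V\mid\mathsf{let}\,x=M\,\mathsf{in}\,N\mid\pi_i(V)\mid V(W)\mid V[A]\mid V[Loc]$. Code names $F::=F_{name}[\overline{Loc}\,\overline A]$; code $\overline l\,\overline\alpha.\overline z.OpenCode$ with $OpenCode::=\lambda x.M\mid\Lambda l.V$; code types $\overline l\,\overline\alpha.\overline B.A$; function maps $\Phi$ are sets of bindings $F_{name}:Ty=Code$; programs are pairs $(\Phi_{\mathbf c},\Phi_{\mathbf s})$. If $\Phi_a$ binds $F_{name}$ to $\overline l\,\overline\alpha.\overline z.OpenCode$, then $\Phi_a(F_{name}[\overline{Loc}\,\overline A])=\overline z.(OpenCode\{\overline{Loc}\,\overline A/\overline l\,\overline\alpha\})$. Contexts: $E[\,]::=E_{let}[\,]\mid\mathsf{do}\,x\leftarrow E[\,]\,\mathsf{in}\,M$; $E_{let}[\,]::=[\,]\mid\mathsf{let}\,x=E_{let}[\,]\,\mathsf{in}\,M$. Stacks $\Delta::=\epsilon\mid E[\,];\Delta$. Configurations $\langle M;\Delta_{\mathbf c}\mid\Delta_{\mathbf s}\rangle$ or $\langle\Delta_{\mathbf c}\mid M;\Delta_{\mathbf s}\rangle$;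 $\langle M\mid\epsilon\rangle$ means $\langle M;\epsilon\mid\epsilon\rangle$. $\Sigma_{\mathbf c}[\,]=\langle E[\,];\Delta_{\mathbf c}\mid\Delta_{\mathbf s}\rangle$, $\Sigma_{\mathbf s}[\,]=\langle\Delta_{\mathbf c}\mid E[\,];\Delta_{\mathbf s}\rangle$. Local steps $\longrightarrow^a$: $\mathsf{let}\,x=V\,\mathsf{in}\,M\to M\{V/x\}$; $\mathsf{do}\,x\leftarrow\mathsf{unit}\,V\,\mathsf{in}\,M\to M\{V/x\}$; $\pi_i(V_1,V_2)\to V_i$; $(\Lambda\alpha.V)[A]\to V\{A/\alpha\}$; $clo(\overline W,F)(V)\to M\{\overline W/\overline z\}\{V/x\}$ if $\Phi_a(F)=\overline z.\lambda x.M$; $clo(\overline W,F)[b]\to V\{\overline W/\overline z\}\{b/l\}$ if $\Phi_a(F)=\overline z.\Lambda l.V$. If $M\longrightarrow^aM'$ then $\Sigma_a[M]\longrightarrow\Sigma_a[M']$. Communication steps: - $\langle E[\mathsf{req}(V,W)];\Delta_{\mathbf c}\mid\Delta_{\mathbf s}\rangle\to\langle E[\,];\Delta_{\mathbf c}\mid V(W);\Delta_{\mathbf s}\rangle$ - $\langle\Delta_{\mathbf c}\mid E[\mathsf{call}(V,W)];\Delta_{\mathbf s}\rangle\to\langle V(W);\Delta_{\mathbf c}\mid E[\,];\Delta_{\mathbf s}\rangle$ - $\langle\mathsf{unit}\,V;\Delta_{\mathbf c}\mid E[\,];\Delta_{\mathbf s}\rangle\to\langle\Delta_{\mathbf c}\mid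 E[\mathsf{unit}\,V];\Delta_{\mathbf s}\rangle$ - $\langle E[\,];\Delta_{\mathbf c}\mid\mathsf{unit}\,V;\Delta_{\mathbf s}\rangle\to\langle E[\mathsf{unit}\,V];\Delta_{\mathbf c}\mid\Delta_{\mathbf s}\rangle$ - $\langle\epsilon\mid\mathsf{unit}\,V;\epsilon\rangle\to\langle\mathsf{unit}\,V;\epsilon\mid\epsilon\rangle$ - On the client, $E[\mathsf{gen}(\mathbf c,V,W)]\to E[V(W)]$ and $E[\mathsf{gen}(\mathbf s,V,W)]\to E[\mathsf{req}(V,W)]$; on the server, $E[\mathsf{gen}(\mathbf c,V,W)]\to E[\mathsf{call}(V,W)]$ and $E[\mathsf{gen}(\mathbf s,V,W)]\to E[V(W)]$ (stacks unchanged). **Type compilation.** $\mathcal V[\![\alpha]\!]=\alpha$; $\mathcal V[\![base]\!]=base$; $\mathcal V[\![A\xrightarrow{Loc}B]\!]=Clo(\mathcal V[\![A]\!]\xrightarrow{Loc}\mathcal C[\![B]\!])$; $\mathcal V[\![\forall\alpha.A]\!]=\forall\alpha.\mathcal C[\![A]\!]$; $\mathcal V[\![A\times B]\!]=\mathcal V[\![A]\!]\times\mathcal V[\![B]\!]$; $\mathcal V[\![\forall l.A]\!]=Clo(\forall l.\mathcal C[\![A]\!])$; $\mathcal C[\![A]\!]=T\,(\mathcal V[\![A]\!])$. **Term compilation** (on typing derivations; subscripts record environment, location and type). Values: - $\mathcal V[\![x]\!]_{\Gamma,Loc,A}=x$. - $\mathcal V[\![\lambda^{Loc'}x.M]\!]_{\Gamma,Loc,A\xrightarrow{Loc'}B}=clo(\overline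 z,F_{name}[\overline l\,\overline\alpha])$, where $\Gamma=\{\overline l,\overline\alpha,\overline{z:C}\}$, $F_{name}$ is fresh, and $F_{name}:\overline l\,\overline\alpha.\overline{\mathcal V[\![C]\!]}.\mathcal V[\![A]\!]\xrightarrow{Loc'}\mathcal C[\![B]\!]=\overline l\,\overline\alpha.\overline z.\lambda x.\mathcal C[\![M]\!]_{(\Gamma,x:A),Loc',B}$ is added to the map at $Loc'$ (to both maps if $Loc'$ is a variable). - $\mathcal V[\![\Lambda l.V]\!]_{\Gamma,Loc,\forall l.A}=clo(\overline z,F_{name}[\overline l\,\overline\alpha])$ with $\Gamma$ as before, $F_{name}$ fresh, and $F_{name}:\overline l\,\overline\alpha.\overline{\mathcal V[\![C]\!]}.\forall l.\mathcal C[\![A]\!]=\overline l\,\overline\alpha.\overline z.\Lambda l.\mathcal C[\![V]\!]_{(\Gamma,l),Loc,A}$ added to both maps. - $\mathcal V[\![\Lambda\alpha.V]\!]_{\Gamma,Loc,\forall\alpha.A}=\Lambda\alpha.\mathcal C[\![V]\!]_{(\Gamma,\alpha),Loc,A}$; $\mathcal V[\![(V,W)]\!]_{\Gamma,Loc,A\times B}=(\mathcal V[\![V]\!]_{\Gamma,Loc,A},\mathcal V[\![W]\!]_{\Gamma,Loc,B})$. Terms (the first clause applies to values): - $\mathcal C[\![V]\!]_{\Gamma,Loc,A}=\mathsf{unit}\,(\mathcal V[\![V]\!]_{\Gamma,Loc,A})$. - $\mathcal C[\![L\,M]\!]_{\Gamma,Loc,B}=\mathsf{do}\,f\leftarrow\mathcal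 C[\![L]\!]_{\Gamma,Loc,A\xrightarrow{Loc'}B}\,\mathsf{in}\,\mathsf{do}\,x\leftarrow\mathcal C[\![M]\!]_{\Gamma,Loc,A}\,\mathsf{in}\,R$, where $R=f(x)$ if $Loc=Loc'$; $R=\mathsf{req}(f,x)$ if $Loc=\mathbf c,Loc'=\mathbf s$; $R=\mathsf{call}(f,x)$ if $Loc=\mathbf s,Loc'=\mathbf c$; $R=\mathsf{gen}(Loc',f,x)$ otherwise. - $\mathcal C[\![M[B]]\!]_{\Gamma,Loc,A\{B/\alpha\}}=\mathsf{do}\,f\leftarrow\mathcal C[\![M]\!]_{\Gamma,Loc,\forall\alpha.A}\,\mathsf{in}\,f[\mathcal V[\![B]\!]]$; $\mathcal C[\![M[Loc']]\!]_{\Gamma,Loc,A\{Loc'/l\}}=\mathsf{do}\,f\leftarrow\mathcal C[\![M]\!]_{\Gamma,Loc,\forall l.A}\,\mathsf{in}\,f[Loc']$. - $\mathcal C[\![(L,M)]\!]_{\Gamma,Loc,A\times B}=\mathsf{do}\,x\leftarrow\mathcal C[\![L]\!]_{\Gamma,Loc,A}\,\mathsf{in}\,\mathsf{do}\,y\leftarrow\mathcal C[\![M]\!]_{\Gamma,Loc,B}\,\mathsf{in}\,\mathsf{unit}\,(x,y)$; $\mathcal C[\![\pi_i(M)]\!]_{\Gamma,Loc,A_i}=\mathsf{do}\,p\leftarrow\mathcal C[\![M]\!]_{\Gamma,Loc,A_1\times A_2}\,\mathsf{in}\,\mathsf{let}\,x=\pi_i(p)\,\mathsf{in}\,\mathsf{unit}\,x$.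 Bound variables introduced by the compilation are chosen fresh. The function maps $(\Phi_{\mathbf c},\Phi_{\mathbf s})$ consist of the bindings generated by the compilation.
   Formalization: Literal identity fails as run-time closures keep captured values and instantiated gen stays undispatched; so the final term equals some compilation of V (with its own fresh maps) only up to closure code and gen dispatch. Location and type variables must be declared in Γ. *)

(* Defs.v *)
From Stdlib Require Import List Arith Relations.
Import ListNotations.

(* Location, type and term variables are three separate de Bruijn index
   spaces.  Renamings and substitutions act on all three simultaneously, so
   that crossing a binder of one kind shifts the images of the others. *)

Inductive site := client | server.

Inductive loc := LC (a : site) | LV (l : nat).

Definition loc_eq_dec (L L' : loc) : {L = L'} + {L <> L'}.
Proof. decide equality; [decide equality | apply Nat.eq_dec]. Defined.

Definition scons {X : Type} (x : X) (s : nat -> X) (n : nat) : X :=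
  match n with 0 => x | S k => s k end.

(* [insts [x0; ..; xk] s] sends index i <= k to xi, index k+1+j to [s j]. *)
Definition insts {X : Type} (xs : list X) (s : nat -> X) : nat -> X :=
  fold_right scons s xs.

Definition id_ren (n : nat) : nat := n.
Definition up_ren (r : nat -> nat) : nat -> nat := scons 0 (fun n => S (r n)).

Definition loc_sub (sl : nat -> loc) (L : loc) : loc :=
  match L with LC a => LC a | LV l => sl l end.
Definition loc_ren (rl : nat -> nat) : loc -> loc := loc_sub (fun n => LV (rl n)).
Definition up_loc (sl : nat -> loc) : nat -> loc :=
  scons (LV 0) (fun n => loc_ren S (sl n)).

Inductive proj := pi1 | pi2.
Definition pick {X : Type} (i : proj) (x y : X) : X :=
  match i with pi1 => x | pi2 => y end.

(** * Polymorphic RPC calculus *)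

Inductive sty :=
| SBase
| SArr (A : sty) (L : loc) (B : sty)
| STVar (n : nat)
| SProd (A B : sty)
| SAllT (A : sty)
| SAllL (A : sty).

Fixpoint sty_ren (rl rt : nat -> nat) (A : sty) : sty :=
  match A with
  | SBase => SBase
  | SArr A L B => SArr (sty_ren rl rt A) (loc_ren rl L) (sty_ren rl rt B)
  | STVar n => STVar (rt n)
  | SProd A B => SProd (sty_ren rl rt A) (sty_ren rl rt B)
  | SAllT A => SAllT (sty_ren rl (up_ren rt) A)
  | SAllL A => SAllL (sty_ren (up_ren rl) rt A)
  end.

Definition up_sty (st : nat -> sty) : nat -> sty :=
  scons (STVar 0) (fun n => sty_ren id_ren S (st n)).

Fixpoint sty_sub (sl : nat -> loc) (st : nat -> sty) (A : sty) : sty :=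
  match A with
  | SBase => SBase
  | SArr A L B => SArr (sty_sub sl st A) (loc_sub sl L) (sty_sub sl st B)
  | STVar n => st n
  | SProd A B => SProd (sty_sub sl st A) (sty_sub sl st B)
  | SAllT A => SAllT (sty_sub sl (up_sty st) A)
  | SAllL A =>
      SAllL (sty_sub (up_loc sl) (fun n => sty_ren S id_ren (st n)) A)
  end.

(* One sort for terms and values, because the grammars of pairs of values and
   of pairs of terms overlap. *)
Inductive stm :=
| SVar (n : nat)
| SLam (L : loc) (M : stm)
| STLam (V : stm)
| SLLam (V : stm)
| SApp (M N : stm)
| STApp (M : stm) (A : sty)
| SLApp (M : stm) (L : loc)
| SPair (M N : stm)
| SProj (i : proj) (M : stm).

Inductive svalue : stm -> Prop :=
| svalue_var n : svalue (SVar n)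
| svalue_lam L M : svalue (SLam L M)
| svalue_tlam V : svalue V -> svalue (STLam V)
| svalue_llam V : svalue V -> svalue (SLLam V)
| svalue_pair V W : svalue V -> svalue W -> svalue (SPair V W).

Fixpoint stm_ren (rl rt rv : nat -> nat) (M : stm) : stm :=
  match M with
  | SVar n => SVar (rv n)
  | SLam L M => SLam (loc_ren rl L) (stm_ren rl rt (up_ren rv) M)
  | STLam V => STLam (stm_ren rl (up_ren rt) rv V)
  | SLLam V => SLLam (stm_ren (up_ren rl) rt rv V)
  | SApp M N => SApp (stm_ren rl rt rv M) (stm_ren rl rt rv N)
  | STApp M A => STApp (stm_ren rl rt rv M) (sty_ren rl rt A)
  | SLApp M L => SLApp (stm_ren rl rt rv M) (loc_ren rl L)
  | SPair M N => SPair (stm_ren rl rt rv M) (stm_ren rl rt rv N)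
  | SProj i M => SProj i (stm_ren rl rt rv M)
  end.

Definition up_stm (sv : nat -> stm) : nat -> stm :=
  scons (SVar 0) (fun n => stm_ren id_ren id_ren S (sv n)).

Fixpoint stm_sub (sl : nat -> loc) (st : nat -> sty) (sv : nat -> stm)
    (M : stm) : stm :=
  match M with
  | SVar n => sv n
  | SLam L M => SLam (loc_sub sl L) (stm_sub sl st (up_stm sv) M)
  | STLam V =>
      STLam (stm_sub sl (up_sty st) (fun n => stm_ren id_ren S id_ren (sv n)) V)
  | SLLam V =>
      SLLam (stm_sub (up_loc sl) (fun n => sty_ren S id_ren (st n))
               (fun n => stm_ren S id_ren id_ren (sv n)) V)
  | SApp M N => SApp (stm_sub sl st sv M) (stm_sub sl st sv N)
  | STApp M A => STApp (stm_sub sl st sv M) (sty_sub sl st A)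
  | SLApp M L => SLApp (stm_sub sl st sv M) (loc_sub sl L)
  | SPair M N => SPair (stm_sub sl st sv M) (stm_sub sl st sv N)
  | SProj i M => SProj i (stm_sub sl st sv M)
  end.

(* An environment declares [e_locs] location variables, [e_tys] type variables
   and the term variables of [e_vars]; the types in [e_vars] live in the full
   scope, hence the shifts in [env_ty] and [env_loc]. *)
Record env := Env { e_locs : nat; e_tys : nat; e_vars : list sty }.

Definition empty_env : env := Env 0 0 [].
Definition env_var (G : env) (A : sty) : env :=
  Env (e_locs G) (e_tys G) (A :: e_vars G).
Definition env_ty (G : env) : env :=
  Env (e_locs G) (S (e_tys G)) (map (sty_ren id_ren S) (e_vars G)).
Definition env_loc (G : env) : env :=
  Env (S (e_locs G)) (e_tys G) (map (sty_ren S id_ren) (e_vars G)).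

Definition loc_in (nl : nat) (L : loc) : Prop :=
  match L with LC _ => True | LV l => l < nl end.

Fixpoint sty_in (nl nt : nat) (A : sty) : Prop :=
  match A with
  | SBase => True
  | SArr A L B => sty_in nl nt A /\ loc_in nl L /\ sty_in nl nt B
  | STVar n => n < nt
  | SProd A B => sty_in nl nt A /\ sty_in nl nt B
  | SAllT A => sty_in nl (S nt) A
  | SAllL A => sty_in (S nl) nt A
  end.

(* Location and type variables must be declared: an undeclared index has no
   stable meaning once a function body is moved into closed code. *)
Definition loc_ok (G : env) (L : loc) : Prop := loc_in (e_locs G) L.
Definition sty_ok (G : env) (A : sty) : Prop := sty_in (e_locs G) (e_tys G) A.

Inductive typing : env -> loc -> stm -> sty -> Prop :=
| t_var G L n A :
    nth_error (e_vars G) n = Some A ->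
    typing G L (SVar n) A
| t_lam G L L' M A B :
    loc_ok G L' -> sty_ok G A ->
    typing (env_var G A) L' M B ->
    typing G L (SLam L' M) (SArr A L' B)
| t_app G L L' M N A B :
    typing G L M (SArr A L' B) ->
    typing G L N A ->
    typing G L (SApp M N) B
| t_tlam G L V A :
    svalue V ->
    typing (env_ty G) L V A ->
    typing G L (STLam V) (SAllT A)
| t_tapp G L M A B :
    sty_ok G B ->
    typing G L M (SAllT A) ->
    typing G L (STApp M B) (sty_sub LV (scons B STVar) A)
| t_llam G L V A :
    svalue V ->
    typing (env_loc G) (loc_ren S L) V A ->
    typing G L (SLLam V) (SAllL A)
| t_lapp G L L' M A :
    loc_ok G L' ->
    typing G L M (SAllL A) ->
    typing G L (SLApp M L') (sty_sub (scons L' LV) STVar A)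
| t_pair G L M N A B :
    typing G L M A ->
    typing G L N B ->
    typing G L (SPair M N) (SProd A B)
| t_proj G L i M A1 A2 :
    typing G L M (SProd A1 A2) ->
    typing G L (SProj i M) (pick i A1 A2).

Inductive eval : site -> stm -> stm -> Prop :=
| ev_lam a b M : eval a (SLam (LC b) M) (SLam (LC b) M)
| ev_tlam a V : svalue V -> eval a (STLam V) (STLam V)
| ev_llam a V : svalue V -> eval a (SLLam V) (SLLam V)
| ev_app a b L M N V W :
    eval a L (SLam (LC b) N) ->
    eval a M W ->
    eval b (stm_sub LV STVar (scons W SVar) N) V ->
    eval a (SApp L M) V
| ev_tapp a M V B :
    eval a M (STLam V) ->
    eval a (STApp M B) (stm_sub LV (scons B STVar) SVar V)
| ev_lapp a b M V :
    eval a M (SLLam V) ->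
    eval a (SLApp M (LC b)) (stm_sub (scons (LC b) LV) STVar SVar V)
| ev_pair a L M V W :
    eval a L V ->
    eval a M W ->
    eval a (SPair L M) (SPair V W)
| ev_proj a i M V1 V2 :
    eval a M (SPair V1 V2) ->
    eval a (SProj i M) (pick i V1 V2).

(** * Polymorphic client-server calculus *)

Inductive tty :=
| TyBase
| TyArr (A : tty) (L : loc) (B : tty)
| TyClo (A : tty)
| TyProd (A B : tty)
| TyVar (n : nat)
| TyAllT (A : tty)
| TyAllL (A : tty)
| TyT (A : tty).

Fixpoint tty_ren (rl rt : nat -> nat) (A : tty) : tty :=
  match A with
  | TyBase => TyBase
  | TyArr A L B => TyArr (tty_ren rl rt A) (loc_ren rl L) (tty_ren rl rt B)
  | TyClo A => TyClo (tty_ren rl rt A)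
  | TyProd A B => TyProd (tty_ren rl rt A) (tty_ren rl rt B)
  | TyVar n => TyVar (rt n)
  | TyAllT A => TyAllT (tty_ren rl (up_ren rt) A)
  | TyAllL A => TyAllL (tty_ren (up_ren rl) rt A)
  | TyT A => TyT (tty_ren rl rt A)
  end.

Definition up_tty (st : nat -> tty) : nat -> tty :=
  scons (TyVar 0) (fun n => tty_ren id_ren S (st n)).

Fixpoint tty_sub (sl : nat -> loc) (st : nat -> tty) (A : tty) : tty :=
  match A with
  | TyBase => TyBase
  | TyArr A L B => TyArr (tty_sub sl st A) (loc_sub sl L) (tty_sub sl st B)
  | TyClo A => TyClo (tty_sub sl st A)
  | TyProd A B => TyProd (tty_sub sl st A) (tty_sub sl st B)
  | TyVar n => st n
  | TyAllT A => TyAllT (tty_sub sl (up_tty st) A)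
  | TyAllL A =>
      TyAllL (tty_sub (up_loc sl) (fun n => tty_ren S id_ren (st n)) A)
  | TyT A => TyT (tty_sub sl st A)
  end.

Definition fname := nat.

(* [VClo Ws F Ls As] is clo(Ws, F[Ls As]).  [VDo M N] and [TLet M N] bind
   term variable 0 in [N]. *)
Inductive val :=
| VVar (n : nat)
| VPair (V W : val)
| VClo (Ws : list val) (F : fname) (Ls : list loc) (As : list tty)
| VTLam (V : val)
| VUnit (V : val)
| VDo (M N : tm)
| VReq (V W : val)
| VCall (V W : val)
| VGen (L : loc) (V W : val)
with tm :=
| TVal (V : val)
| TLet (M N : tm)
| TProj (i : proj) (V : val)
| TApp (V W : val)
| TTApp (V : val) (A : tty)
| TLApp (V : val) (L : loc).

Fixpoint val_ren (rl rt rv : nat -> nat) (V : val) : val :=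
  match V with
  | VVar n => VVar (rv n)
  | VPair V W => VPair (val_ren rl rt rv V) (val_ren rl rt rv W)
  | VClo Ws F Ls As =>
      VClo (map (val_ren rl rt rv) Ws) F
        (map (loc_ren rl) Ls) (map (tty_ren rl rt) As)
  | VTLam V => VTLam (val_ren rl (up_ren rt) rv V)
  | VUnit V => VUnit (val_ren rl rt rv V)
  | VDo M N => VDo (tm_ren rl rt rv M) (tm_ren rl rt (up_ren rv) N)
  | VReq V W => VReq (val_ren rl rt rv V) (val_ren rl rt rv W)
  | VCall V W => VCall (val_ren rl rt rv V) (val_ren rl rt rv W)
  | VGen L V W =>
      VGen (loc_ren rl L) (val_ren rl rt rv V) (val_ren rl rt rv W)
  end
with tm_ren (rl rt rv : nat -> nat) (M : tm) : tm :=
  match M with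
  | TVal V => TVal (val_ren rl rt rv V)
  | TLet M N => TLet (tm_ren rl rt rv M) (tm_ren rl rt (up_ren rv) N)
  | TProj i V => TProj i (val_ren rl rt rv V)
  | TApp V W => TApp (val_ren rl rt rv V) (val_ren rl rt rv W)
  | TTApp V A => TTApp (val_ren rl rt rv V) (tty_ren rl rt A)
  | TLApp V L => TLApp (val_ren rl rt rv V) (loc_ren rl L)
  end.

Definition up_val (sv : nat -> val) : nat -> val :=
  scons (VVar 0) (fun n => val_ren id_ren id_ren S (sv n)).

Fixpoint val_sub (sl : nat -> loc) (st : nat -> tty) (sv : nat -> val)
    (V : val) : val :=
  match V with
  | VVar n => sv n
  | VPair V W => VPair (val_sub sl st sv V) (val_sub sl st sv W)
  | VClo Ws F Ls As =>
      VClo (map (val_sub sl st sv) Ws) F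
        (map (loc_sub sl) Ls) (map (tty_sub sl st) As)
  | VTLam V =>
      VTLam (val_sub sl (up_tty st) (fun n => val_ren id_ren S id_ren (sv n)) V)
  | VUnit V => VUnit (val_sub sl st sv V)
  | VDo M N => VDo (tm_sub sl st sv M) (tm_sub sl st (up_val sv) N)
  | VReq V W => VReq (val_sub sl st sv V) (val_sub sl st sv W)
  | VCall V W => VCall (val_sub sl st sv V) (val_sub sl st sv W)
  | VGen L V W =>
      VGen (loc_sub sl L) (val_sub sl st sv V) (val_sub sl st sv W)
  end
with tm_sub (sl : nat -> loc) (st : nat -> tty) (sv : nat -> val)
    (M : tm) : tm :=
  match M with
  | TVal V => TVal (val_sub sl st sv V)
  | TLet M N => TLet (tm_sub sl st sv M) (tm_sub sl st (up_val sv) N)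
  | TProj i V => TProj i (val_sub sl st sv V)
  | TApp V W => TApp (val_sub sl st sv V) (val_sub sl st sv W)
  | TTApp V A => TTApp (val_sub sl st sv V) (tty_sub sl st A)
  | TLApp V L => TLApp (val_sub sl st sv V) (loc_sub sl L)
  end.

Inductive opencode := OLam (M : tm) | OLLam (V : val).

Definition opencode_sub (sl : nat -> loc) (st : nat -> tty) (sv : nat -> val)
    (O : opencode) : opencode :=
  match O with
  | OLam M => OLam (tm_sub sl st (up_val sv) M)
  | OLLam V =>
      OLLam (val_sub (up_loc sl) (fun n => tty_ren S id_ren (st n))
               (fun n => val_ren S id_ren id_ren (sv n)) V)
  end.

Record code := Code {
  c_locs : nat; c_tys : nat; c_vars : nat; c_body : opencode }.
Record codety := CodeTy {
  ct_locs : nat; ct_tys : nat; ct_vars : list tty; ct_body : tty }.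

Definition fmap := list (fname * (codety * code)).
Definition fmaps := site -> fmap.

(* [closure_code Phi Ws F Ls As T O]: Phi(F[Ls As]) = zs.O' with O = O'{Ws/zs},
   and T is the type of O' in the instantiated code type of F. *)
Definition closure_code (Phi : fmap) (Ws : list val) (F : fname)
    (Ls : list loc) (As : list tty) (T : tty) (O : opencode) : Prop :=
  exists (CT : codety) (K : code),
    In (F, (CT, K)) Phi /\
    length Ls = c_locs K /\ length As = c_tys K /\ length Ws = c_vars K /\
    T = tty_sub (insts Ls LV) (insts As TyVar) (ct_body CT) /\
    O = opencode_sub (insts Ls LV) (insts As TyVar) (insts Ws VVar) (c_body K).

Inductive elet := EHole | ELet (E : elet) (N : tm).
Inductive ectx := EIn (E : elet) | EDo (E : ectx) (N : tm).

Fixpoint plug_let (E : elet) (M : tm) : tm :=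
  match E with EHole => M | ELet E N => TLet (plug_let E M) N end.
Fixpoint plug (E : ectx) (M : tm) : tm :=
  match E with
  | EIn E => plug_let E M
  | EDo E N => TVal (VDo (plug E M) N)
  end.

Definition stack := list ectx.

Inductive config :=
| OnClient (M : tm) (Dc Ds : stack)
| OnServer (Dc : stack) (M : tm) (Ds : stack).

Definition config_at (a : site) (M : tm) (Dc Ds : stack) : config :=
  match a with client => OnClient M Dc Ds | server => OnServer Dc M Ds end.

Inductive lstep (Phi : fmap) : tm -> tm -> Prop :=
| ls_let V M :
    lstep Phi (TLet (TVal V) M) (tm_sub LV TyVar (scons V VVar) M)
| ls_do V M :
    lstep Phi (TVal (VDo (TVal (VUnit V)) M)) (tm_sub LV TyVar (scons V VVar) M)
| ls_proj i V1 V2 :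
    lstep Phi (TProj i (VPair V1 V2)) (TVal (pick i V1 V2))
| ls_tapp V A :
    lstep Phi (TTApp (VTLam V) A) (TVal (val_sub LV (scons A TyVar) VVar V))
| ls_app Ws F Ls As T V M :
    closure_code Phi Ws F Ls As T (OLam M) ->
    lstep Phi (TApp (VClo Ws F Ls As) V) (tm_sub LV TyVar (scons V VVar) M)
| ls_lapp Ws F Ls As T b V :
    closure_code Phi Ws F Ls As T (OLLam V) ->
    lstep Phi (TLApp (VClo Ws F Ls As) (LC b))
      (TVal (val_sub (scons (LC b) LV) TyVar VVar V)).

(* How code running at L applies V, a function living at L', to W. *)
Definition invoke (L L' : loc) (V W : val) : tm :=
  if loc_eq_dec L L' then TApp V W
  else match L, L' with
       | LC client, LC server => TVal (VReq V W)
       | LC server, LC client => TVal (VCall V W)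
       | _, _ => TVal (VGen L' V W)
       end.

Inductive step (P : fmaps) : config -> config -> Prop :=
| s_local a E M M' Dc Ds :
    lstep (P a) M M' ->
    step P (config_at a (plug E M) Dc Ds) (config_at a (plug E M') Dc Ds)
| s_req E V W Dc Ds :
    step P (OnClient (plug E (TVal (VReq V W))) Dc Ds)
           (OnServer (E :: Dc) (TApp V W) Ds)
| s_call E V W Dc Ds :
    step P (OnServer Dc (plug E (TVal (VCall V W))) Ds)
           (OnClient (TApp V W) Dc (E :: Ds))
| s_to_server E V Dc Ds :
    step P (OnClient (TVal (VUnit V)) Dc (E :: Ds))
           (OnServer Dc (plug E (TVal (VUnit V))) Ds)
| s_to_client E V Dc Ds :
    step P (OnServer (E :: Dc) (TVal (VUnit V)) Ds)
           (OnClient (plug E (TVal (VUnit V))) Dc Ds)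
| s_finish V :
    step P (OnServer [] (TVal (VUnit V)) []) (OnClient (TVal (VUnit V)) [] [])
| s_gen a b E V W Dc Ds :
    step P (config_at a (plug E (TVal (VGen (LC b) V W))) Dc Ds)
           (config_at a (plug E (invoke (LC a) (LC b) V W)) Dc Ds).

Definition steps (P : fmaps) : config -> config -> Prop :=
  clos_refl_trans config (step P).

(** * Compilation *)

Fixpoint vty (A : sty) : tty :=
  match A with
  | SBase => TyBase
  | SArr A L B => TyClo (TyArr (vty A) L (TyT (vty B)))
  | STVar n => TyVar n
  | SProd A B => TyProd (vty A) (vty B)
  | SAllT A => TyAllT (TyT (vty A))
  | SAllL A => TyClo (TyAllL (TyT (vty A)))
  end.
Definition cty (A : sty) : tty := TyT (vty A).

Definition hosted (L : loc) (a : site) : Prop :=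
  match L with LC b => a = b | LV _ => True end.
Definition hosted_dec (L : loc) (a : site) : {hosted L a} + {~ hosted L a}.
Proof. destruct L; simpl; [decide equality | left; exact I]. Defined.

Definition no_code : fmaps := fun _ => [].
Definition join (P Q : fmaps) : fmaps := fun a => P a ++ Q a.
Definition add_code (L : loc) (F : fname) (T : codety) (K : code) (P : fmaps) :
    fmaps :=
  fun a => if hosted_dec L a then (F, (T, K)) :: P a else P a.
Definition add_code_both (F : fname) (T : codety) (K : code) (P : fmaps) :
    fmaps :=
  fun a => (F, (T, K)) :: P a.

Definition fresh (F : fname) (P : fmaps) : Prop :=
  forall a, ~ In F (map fst (P a)).
Definition disjoint (P Q : fmaps) : Prop :=
  forall F, fresh F P \/ fresh F Q.

(* clo(zs, F[ls alphas]) over all the variables declared in [G]. *)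
Definition env_closure (G : env) (F : fname) : val :=
  VClo (map VVar (seq 0 (length (e_vars G)))) F
    (map LV (seq 0 (e_locs G))) (map TyVar (seq 0 (e_tys G))).
Definition env_code (G : env) (O : opencode) : code :=
  Code (e_locs G) (e_tys G) (length (e_vars G)) O.
Definition env_codety (G : env) (T : tty) : codety :=
  CodeTy (e_locs G) (e_tys G) (map vty (e_vars G)) T.

Definition shift1 : tm -> tm := tm_ren id_ren id_ren S.

(* [vcomp G L V A W P] (resp. [ccomp G L M A N P]): W (resp. N) is the value
   (resp. term) compilation of a derivation of G |-_L V : A (resp. M : A), and
   P consists of the code bindings it generates.  Terms do not determine their
   derivations, since the types of bound variables are not annotated, and
   function names are only required to be fresh; hence relations. *)
Inductive vcomp : env -> loc -> stm -> sty -> val -> fmaps -> Prop :=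
| v_var G L n A :
    nth_error (e_vars G) n = Some A ->
    vcomp G L (SVar n) A (VVar n) no_code
| v_lam G L L' M A B N F P :
    loc_ok G L' -> sty_ok G A ->
    ccomp (env_var G A) L' M B N P ->
    fresh F P ->
    vcomp G L (SLam L' M) (SArr A L' B) (env_closure G F)
      (add_code L' F (env_codety G (TyArr (vty A) L' (cty B)))
         (env_code G (OLam N)) P)
| v_llam G L V A W F P :
    vcomp (env_loc G) (loc_ren S L) V A W P ->
    fresh F P ->
    vcomp G L (SLLam V) (SAllL A) (env_closure G F)
      (add_code_both F (env_codety G (TyAllL (cty A)))
         (env_code G (OLLam (VUnit W))) P)
| v_tlam G L V A W P :
    vcomp (env_ty G) L V A W P ->
    vcomp G L (STLam V) (SAllT A) (VTLam (VUnit W)) P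
| v_pair G L V1 V2 A1 A2 W1 W2 P1 P2 :
    vcomp G L V1 A1 W1 P1 ->
    vcomp G L V2 A2 W2 P2 ->
    disjoint P1 P2 ->
    vcomp G L (SPair V1 V2) (SProd A1 A2) (VPair W1 W2) (join P1 P2)
with ccomp : env -> loc -> stm -> sty -> tm -> fmaps -> Prop :=
| c_val G L V A W P :
    vcomp G L V A W P ->
    ccomp G L V A (TVal (VUnit W)) P
| c_app G L L' M1 M2 A B N1 N2 P1 P2 :
    ccomp G L M1 (SArr A L' B) N1 P1 ->
    ccomp G L M2 A N2 P2 ->
    disjoint P1 P2 ->
    ccomp G L (SApp M1 M2) B
      (TVal (VDo N1 (TVal (VDo (shift1 N2) (invoke L L' (VVar 1) (VVar 0))))))
      (join P1 P2)
| c_tapp G L M A B N P :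
    sty_ok G B ->
    ccomp G L M (SAllT A) N P ->
    ccomp G L (STApp M B) (sty_sub LV (scons B STVar) A)
      (TVal (VDo N (TTApp (VVar 0) (vty B)))) P
| c_lapp G L L' M A N P :
    loc_ok G L' ->
    ccomp G L M (SAllL A) N P ->
    ccomp G L (SLApp M L') (sty_sub (scons L' LV) STVar A)
      (TVal (VDo N (TLApp (VVar 0) L'))) P
| c_pair G L M1 M2 A1 A2 N1 N2 P1 P2 :
    ~ svalue (SPair M1 M2) ->
    ccomp G L M1 A1 N1 P1 ->
    ccomp G L M2 A2 N2 P2 ->
    disjoint P1 P2 ->
    ccomp G L (SPair M1 M2) (SProd A1 A2)
      (TVal (VDo N1 (TVal (VDo (shift1 N2)
         (TVal (VUnit (VPair (VVar 1) (VVar 0))))))))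
      (join P1 P2)
| c_proj G L i M A1 A2 N P :
    ccomp G L M (SProd A1 A2) N P ->
    ccomp G L (SProj i M) (pick i A1 A2)
      (TVal (VDo N (TLet (TProj i (VVar 0)) (TVal (VUnit (VVar 0)))))) P.

(** * Equality of compiled code up to the representation of closures *)

(* Evaluation substitutes values, locations and types for variables of a source
   function, whereas the compiled function stores them in a closure: with
   x : C in the environment, \y.x compiles to clo(x, F), which becomes
   clo(W, F) at run time, whereas the source result \y.w compiles to a closure
   clo(, F') over the empty environment, with its own code name.  Likewise
   gen(l, V, W) in polymorphic code becomes gen(b, V, W), whereas the instantiated
   source compiles to the call that gen(b, V, W) dispatches to.

   [val_eqv P Q L V V'] and [tm_eqv P Q L M M'] are equality of V, M (with
   function maps P) and V', M' (with function maps Q) up to these two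
   differences only: closures are compared by their instantiated code and code
   types, and a gen on the left may be matched by the call it dispatches to.  L is the
   location where the code runs: a function body runs at its own location,
   the body of a polymorphic value at any location. *)
Inductive val_eqv (P Q : fmaps) : loc -> val -> val -> Prop :=
| ve_var L n : val_eqv P Q L (VVar n) (VVar n)
| ve_pair L V W V' W' :
    val_eqv P Q L V V' -> val_eqv P Q L W W' ->
    val_eqv P Q L (VPair V W) (VPair V' W')
| ve_lam L A L0 B Ws F Ls As M Ws' F' Ls' As' M' :
    (forall a, hosted L0 a ->
       closure_code (P a) Ws F Ls As (TyArr A L0 B) (OLam M)) ->
    (forall a, hosted L0 a ->
       closure_code (Q a) Ws' F' Ls' As' (TyArr A L0 B) (OLam M')) ->
    tm_eqv P Q L0 M M' ->
    val_eqv P Q L (VClo Ws F Ls As) (VClo Ws' F' Ls' As')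
| ve_llam L A Ws F Ls As V Ws' F' Ls' As' V' :
    (forall a, closure_code (P a) Ws F Ls As (TyAllL A) (OLLam V)) ->
    (forall a, closure_code (Q a) Ws' F' Ls' As' (TyAllL A) (OLLam V')) ->
    (forall L0, val_eqv P Q L0 V V') ->
    val_eqv P Q L (VClo Ws F Ls As) (VClo Ws' F' Ls' As')
| ve_tlam L V V' :
    (forall L0, val_eqv P Q L0 V V') ->
    val_eqv P Q L (VTLam V) (VTLam V')
| ve_unit L V V' :
    val_eqv P Q L V V' -> val_eqv P Q L (VUnit V) (VUnit V')
| ve_do L M N M' N' :
    tm_eqv P Q L M M' -> tm_eqv P Q L N N' ->
    val_eqv P Q L (VDo M N) (VDo M' N')
| ve_req L V W V' W' :
    val_eqv P Q L V V' -> val_eqv P Q L W W' ->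
    val_eqv P Q L (VReq V W) (VReq V' W')
| ve_call L V W V' W' :
    val_eqv P Q L V V' -> val_eqv P Q L W W' ->
    val_eqv P Q L (VCall V W) (VCall V' W')
| ve_gen L L0 V W V' W' :
    val_eqv P Q L V V' -> val_eqv P Q L W W' ->
    val_eqv P Q L (VGen L0 V W) (VGen L0 V' W')
with tm_eqv (P Q : fmaps) : loc -> tm -> tm -> Prop :=
| te_val L V V' :
    val_eqv P Q L V V' -> tm_eqv P Q L (TVal V) (TVal V')
| te_dispatch L L0 V W V' W' :
    val_eqv P Q L V V' -> val_eqv P Q L W W' ->
    tm_eqv P Q L (TVal (VGen L0 V W)) (invoke L L0 V' W')
| te_let L M N M' N' :
    tm_eqv P Q L M M' -> tm_eqv P Q L N N' ->
    tm_eqv P Q L (TLet M N) (TLet M' N')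
| te_proj L i V V' :
    val_eqv P Q L V V' -> tm_eqv P Q L (TProj i V) (TProj i V')
| te_app L V W V' W' :
    val_eqv P Q L V V' -> val_eqv P Q L W W' ->
    tm_eqv P Q L (TApp V W) (TApp V' W')
| te_tapp L V V' A :
    val_eqv P Q L V V' -> tm_eqv P Q L (TTApp V A) (TTApp V' A)
| te_lapp L V V' L0 :
    val_eqv P Q L V V' -> tm_eqv P Q L (TLApp V L0) (TLApp V' L0).

(* Main.v *)
(** A value reached at run time is not literally the compilation of the source
   value: its closures hold the values that evaluation substituted, and some
   [gen]s have become concrete.  So the compilation judgment is generalized, for
   fixed function maps, to a run-time compilation relation in which a closure is
   judged by the instantiation of its code.  Because compiled code is closed up
   to its declared variables, this relation is stable under typed simultaneous
   substitution, and a forward simulation follows by induction on evaluation.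
   Finally, a term related to a source value is compared with a fresh compilation
   of that value, with function names taken from disjoint intervals. *)

Require Import Defs.
From Stdlib Require Import List Arith Lia Relations FunctionalExtensionality.
Import ListNotations.

(** * Substitution algebra *)

(** Two features of the compiler do not commute with instantiation. Source substitution enters
    function bodies, while target substitution reaches only the lists stored in a closure and leaves
    the function maps alone; looking at code after instantiation makes both sides move alike.
    Moreover the form of a call is chosen from the locations known at compile time, so instantiating
    a location variable can leave a concrete [gen] where a fresh compilation has a plain
    application, a [req] or a [call]. Both forms have to be accepted, and a [gen] is resolved only
    when it runs. Since [req] and [call] hand over the entire pending context, the simulation speaks
    of all pending [do]s and all stacks rather than of isolated terms. *)

Ltac funext := let n := fresh "n" in
  apply functional_extensionality; intros [|n]; simpl; auto.

Lemma loc_sub_id L : loc_sub LV L = L.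
Proof. destruct L; reflexivity. Qed.

Lemma loc_sub_comp s t L :
  loc_sub t (loc_sub s L) = loc_sub (fun n => loc_sub t (s n)) L.
Proof. destruct L; reflexivity. Qed.

Lemma up_loc_id : up_loc LV = LV.
Proof. funext. Qed.

Lemma up_loc_var r : up_loc (fun n => LV (r n)) = fun n => LV (up_ren r n).
Proof. funext. Qed.

Lemma up_loc_ren s r :
  (fun n => up_loc s (up_ren r n)) = up_loc (fun n => s (r n)).
Proof. funext. Qed.

Lemma up_loc_comp s t :
  (fun n => loc_sub (up_loc t) (up_loc s n)) = up_loc (fun n => loc_sub t (s n)).
Proof. funext. unfold loc_ren. rewrite !loc_sub_comp. reflexivity. Qed.

Lemma ren_up_loc r s :
  (fun n => loc_ren (up_ren r) (up_loc s n)) = up_loc (fun n => loc_ren r (s n)).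
Proof. funext. unfold loc_ren. rewrite !loc_sub_comp. reflexivity. Qed.

Lemma up_sty_var r : up_sty (fun n => STVar (r n)) = fun n => STVar (up_ren r n).
Proof. funext. Qed.

Lemma sty_ren_as_sub A : forall rl rt,
  sty_ren rl rt A = sty_sub (fun n => LV (rl n)) (fun n => STVar (rt n)) A.
Proof.
  induction A; intros; simpl; f_equal; auto.
  - rewrite IHA, up_sty_var; reflexivity.
  - rewrite IHA, up_loc_var; reflexivity.
Qed.

Lemma sty_sub_id A : sty_sub LV STVar A = A.
Proof.
  induction A; simpl; rewrite ?loc_sub_id; f_equal; auto.
  - replace (up_sty STVar) with STVar by funext. auto.
  - rewrite up_loc_id. auto.
Qed.

Lemma sty_sub_ren A : forall sl st rl rt,
  sty_sub sl st (sty_ren rl rt A)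
  = sty_sub (fun n => sl (rl n)) (fun n => st (rt n)) A.
Proof.
  induction A; intros; simpl; f_equal; auto.
  - apply loc_sub_comp.
  - rewrite IHA. f_equal. funext.
  - rewrite IHA, up_loc_ren. reflexivity.
Qed.

Lemma sty_ren_ren A rl rt rl' rt' :
  sty_ren rl' rt' (sty_ren rl rt A)
  = sty_ren (fun n => rl' (rl n)) (fun n => rt' (rt n)) A.
Proof. rewrite !(sty_ren_as_sub _ rl'), sty_sub_ren, sty_ren_as_sub. reflexivity. Qed.

Lemma sty_ren_sub A : forall sl st rl rt,
  sty_ren rl rt (sty_sub sl st A)
  = sty_sub (fun n => loc_ren rl (sl n)) (fun n => sty_ren rl rt (st n)) A.
Proof.
  induction A; intros; simpl; f_equal; auto.
  - apply loc_sub_comp.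
  - rewrite IHA. f_equal. funext. rewrite !sty_ren_ren. reflexivity.
  - rewrite IHA, ren_up_loc. f_equal.
    funext; rewrite !sty_ren_ren; reflexivity.
Qed.

(** Under a binder a lifted substitution meets a shift: [sty_sub_ren] absorbs the shift on one side
    and [sty_ren_sub] on the other. This fixes the order of the fusion lemmas, and the same ladder
    is climbed again for target types and for target terms. *)
Lemma sty_sub_sub A : forall sl st sl' st',
  sty_sub sl' st' (sty_sub sl st A)
  = sty_sub (fun n => loc_sub sl' (sl n)) (fun n => sty_sub sl' st' (st n)) A.
Proof.
  induction A; intros; simpl; f_equal; auto.
  - apply loc_sub_comp.
  - rewrite IHA. f_equal. funext. rewrite sty_sub_ren, sty_ren_sub. f_equal.
    apply functional_extensionality; intro. unfold loc_ren.
    symmetry. apply loc_sub_id.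
  - rewrite IHA, up_loc_comp. f_equal.
    funext; rewrite sty_sub_ren, sty_ren_sub; reflexivity.
Qed.

(** * Target types and the compilation of types *)

Lemma up_tty_var r : up_tty (fun n => TyVar (r n)) = fun n => TyVar (up_ren r n).
Proof. funext. Qed.

Lemma up_tty_id : up_tty TyVar = TyVar.
Proof. funext. Qed.

Lemma tty_ren_as_sub A : forall rl rt,
  tty_ren rl rt A = tty_sub (fun n => LV (rl n)) (fun n => TyVar (rt n)) A.
Proof.
  induction A; intros; simpl; f_equal; auto.
  - rewrite IHA, up_tty_var; reflexivity.
  - rewrite IHA, up_loc_var; reflexivity.
Qed.

Lemma tty_sub_id A : tty_sub LV TyVar A = A.
Proof.
  induction A; simpl; rewrite ?loc_sub_id, ?up_tty_id, ?up_loc_id; f_equal; auto.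
Qed.

Lemma up_tty_ren st r :
  (fun n => up_tty st (up_ren r n)) = up_tty (fun n => st (r n)).
Proof. funext. Qed.

Lemma tty_sub_ren A : forall sl st rl rt,
  tty_sub sl st (tty_ren rl rt A)
  = tty_sub (fun n => sl (rl n)) (fun n => st (rt n)) A.
Proof.
  induction A; intros; simpl; f_equal; auto.
  - apply loc_sub_comp.
  - rewrite IHA, up_tty_ren. reflexivity.
  - rewrite IHA, up_loc_ren. reflexivity.
Qed.

Lemma tty_ren_ren A rl rt rl' rt' :
  tty_ren rl' rt' (tty_ren rl rt A)
  = tty_ren (fun n => rl' (rl n)) (fun n => rt' (rt n)) A.
Proof. rewrite !(tty_ren_as_sub _ rl'), tty_sub_ren, tty_ren_as_sub. reflexivity. Qed.

Lemma ren_up_tty rl rt st :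
  (fun n => tty_ren rl (up_ren rt) (up_tty st n))
  = up_tty (fun n => tty_ren rl rt (st n)).
Proof. funext. rewrite !tty_ren_ren. reflexivity. Qed.

Lemma tty_ren_sub A : forall sl st rl rt,
  tty_ren rl rt (tty_sub sl st A)
  = tty_sub (fun n => loc_ren rl (sl n)) (fun n => tty_ren rl rt (st n)) A.
Proof.
  induction A; intros; simpl; f_equal; auto.
  - apply loc_sub_comp.
  - rewrite IHA, ren_up_tty. reflexivity.
  - rewrite IHA, ren_up_loc. f_equal.
    funext; rewrite !tty_ren_ren; reflexivity.
Qed.

Lemma loc_ren_id L : loc_ren id_ren L = L.
Proof. apply loc_sub_id. Qed.

Lemma up_tty_comp sl' st' st :
  (fun n => tty_sub sl' (up_tty st') (up_tty st n))
  = up_tty (fun n => tty_sub sl' st' (st n)).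
Proof.
  funext. rewrite tty_sub_ren, tty_ren_sub. f_equal.
  apply functional_extensionality; intro. symmetry. apply loc_ren_id.
Qed.

Lemma tty_sub_shift_loc sl st A :
  tty_sub (up_loc sl) (fun n => tty_ren S id_ren (st n)) (tty_ren S id_ren A)
  = tty_ren S id_ren (tty_sub sl st A).
Proof. rewrite tty_sub_ren, tty_ren_sub. reflexivity. Qed.

Lemma tty_sub_sub A : forall sl st sl' st',
  tty_sub sl' st' (tty_sub sl st A)
  = tty_sub (fun n => loc_sub sl' (sl n)) (fun n => tty_sub sl' st' (st n)) A.
Proof.
  induction A; intros; simpl; f_equal; auto.
  - apply loc_sub_comp.
  - rewrite IHA, up_tty_comp. reflexivity.
  - rewrite IHA, up_loc_comp. f_equal.
    funext; apply tty_sub_shift_loc.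
Qed.

Lemma vty_ren A : forall rl rt, vty (sty_ren rl rt A) = tty_ren rl rt (vty A).
Proof. induction A; intros; simpl; congruence. Qed.

Lemma vty_up st : (fun n => vty (up_sty st n)) = up_tty (fun n => vty (st n)).
Proof. funext. apply vty_ren. Qed.

(** Keeps code types in step with source types: a closure whose source type has been instantiated
    must carry the compilation of the instantiated type. *)
Lemma vty_sub A : forall sl st,
  vty (sty_sub sl st A) = tty_sub sl (fun n => vty (st n)) (vty A).
Proof.
  induction A; intros; simpl; rewrite ?IHA, ?IHA1, ?IHA2, ?vty_up; auto.
  do 4 f_equal. funext; apply vty_ren.
Qed.

(** * Mutual induction on target values and terms *)

Section ValInd.
  Context (Pv : val -> Prop) (Pt : tm -> Prop).
  Hypothesis Hvar : forall n, Pv (VVar n).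
  Hypothesis Hpair : forall V W, Pv V -> Pv W -> Pv (VPair V W).
  Hypothesis Hclo : forall Ws F Ls As, Forall Pv Ws -> Pv (VClo Ws F Ls As).
  Hypothesis Htlam : forall V, Pv V -> Pv (VTLam V).
  Hypothesis Hunit : forall V, Pv V -> Pv (VUnit V).
  Hypothesis Hdo : forall M N, Pt M -> Pt N -> Pv (VDo M N).
  Hypothesis Hreq : forall V W, Pv V -> Pv W -> Pv (VReq V W).
  Hypothesis Hcall : forall V W, Pv V -> Pv W -> Pv (VCall V W).
  Hypothesis Hgen : forall L V W, Pv V -> Pv W -> Pv (VGen L V W).
  Hypothesis Hval : forall V, Pv V -> Pt (TVal V).
  Hypothesis Hlet : forall M N, Pt M -> Pt N -> Pt (TLet M N).
  Hypothesis Hproj : forall i V, Pv V -> Pt (TProj i V).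
  Hypothesis Happ : forall V W, Pv V -> Pv W -> Pt (TApp V W).
  Hypothesis Htapp : forall V A, Pv V -> Pt (TTApp V A).
  Hypothesis Hlapp : forall V L, Pv V -> Pt (TLApp V L).

  (** The values captured by a [VClo] sit inside a list, where the generated principle offers no
      induction hypothesis; the inner fixpoint supplies one for each of them. *)
  Fixpoint val_nested_ind (V : val) : Pv V :=
    match V with
    | VVar n => Hvar n
    | VPair V W => Hpair V W (val_nested_ind V) (val_nested_ind W)
    | VClo Ws F Ls As => Hclo Ws F Ls As
        ((fix go (l : list val) : Forall Pv l :=
            match l with
            | [] => Forall_nil _
            | x :: l => Forall_cons x (val_nested_ind x) (go l)
            end) Ws)
    | VTLam V => Htlam V (val_nested_ind V)
    | VUnit V => Hunit V (val_nested_ind V)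
    | VDo M N => Hdo M N (tm_nested_ind M) (tm_nested_ind N)
    | VReq V W => Hreq V W (val_nested_ind V) (val_nested_ind W)
    | VCall V W => Hcall V W (val_nested_ind V) (val_nested_ind W)
    | VGen L V W => Hgen L V W (val_nested_ind V) (val_nested_ind W)
    end
  with tm_nested_ind (M : tm) : Pt M :=
    match M with
    | TVal V => Hval V (val_nested_ind V)
    | TLet M N => Hlet M N (tm_nested_ind M) (tm_nested_ind N)
    | TProj i V => Hproj i V (val_nested_ind V)
    | TApp V W => Happ V W (val_nested_ind V) (val_nested_ind W)
    | TTApp V A => Htapp V A (val_nested_ind V)
    | TLApp V L => Hlapp V L (val_nested_ind V)
    end.

  Lemma val_tm_nested_ind : (forall V, Pv V) /\ (forall M, Pt M).
  Proof. exact (conj val_nested_ind tm_nested_ind). Qed.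
End ValInd.

(** The first branch serves the captured values of a closure, through their induction hypotheses;
    the second serves its locations and types, which have none. *)
Ltac map_tac := rewrite ?map_map;
  first [ apply map_ext_in; let x := fresh "x" in let Hx := fresh "Hx" in
          intros x Hx;
          match goal with H : Forall _ _ |- _ =>
            rewrite Forall_forall in H; specialize (H x Hx) end; auto
        | apply map_ext; intro ].

(** * Substitution in target values and terms *)

Lemma up_val_var r : up_val (fun n => VVar (r n)) = fun n => VVar (up_ren r n).
Proof. funext. Qed.

Lemma ren_as_sub :
  (forall V rl rt rv, val_ren rl rt rv V
     = val_sub (fun n => LV (rl n)) (fun n => TyVar (rt n)) (fun n => VVar (rv n)) V)
  /\ (forall M rl rt rv, tm_ren rl rt rv M
     = tm_sub (fun n => LV (rl n)) (fun n => TyVar (rt n)) (fun n => VVar (rv n)) M).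
Proof.
  apply val_tm_nested_ind; intros; simpl; f_equal; auto using tty_ren_as_sub.
  - map_tac.
  - map_tac. apply tty_ren_as_sub.
  - rewrite H, up_tty_var. reflexivity.
  - rewrite H0, up_val_var. reflexivity.
  - rewrite H0, up_val_var. reflexivity.
Qed.

Definition val_ren_as_sub := proj1 ren_as_sub.
Definition tm_ren_as_sub := proj2 ren_as_sub.

Lemma up_val_id : up_val VVar = VVar.
Proof. funext. Qed.

Lemma sub_id :
  (forall V, val_sub LV TyVar VVar V = V) /\ (forall M, tm_sub LV TyVar VVar M = M).
Proof.
  apply val_tm_nested_ind; intros; simpl; rewrite ?up_val_id, ?up_tty_id;
    f_equal; auto using tty_sub_id, loc_sub_id.
  - rewrite <- map_id. map_tac.
  - rewrite <- map_id. map_tac. apply loc_sub_id.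
  - rewrite <- map_id. map_tac. apply tty_sub_id.
Qed.

Definition val_sub_id := proj1 sub_id.
Definition tm_sub_id := proj2 sub_id.

Lemma up_val_ren sv r :
  (fun n => up_val sv (up_ren r n)) = up_val (fun n => sv (r n)).
Proof. funext. Qed.

Lemma sub_ren :
  (forall V sl st sv rl rt rv, val_sub sl st sv (val_ren rl rt rv V)
     = val_sub (fun n => sl (rl n)) (fun n => st (rt n)) (fun n => sv (rv n)) V)
  /\ (forall M sl st sv rl rt rv, tm_sub sl st sv (tm_ren rl rt rv M)
     = tm_sub (fun n => sl (rl n)) (fun n => st (rt n)) (fun n => sv (rv n)) M).
Proof.
  apply val_tm_nested_ind; intros; simpl; f_equal;
    auto using tty_sub_ren; try apply loc_sub_comp.
  - map_tac.
  - map_tac. apply loc_sub_comp.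
  - map_tac. apply tty_sub_ren.
  - rewrite H, up_tty_ren. reflexivity.
  - rewrite H0, up_val_ren. reflexivity.
  - rewrite H0, up_val_ren. reflexivity.
Qed.

Definition val_sub_ren := proj1 sub_ren.
Definition tm_sub_ren := proj2 sub_ren.

Lemma val_ren_ren V rl rt rv rl' rt' rv' :
  val_ren rl' rt' rv' (val_ren rl rt rv V)
  = val_ren (fun n => rl' (rl n)) (fun n => rt' (rt n)) (fun n => rv' (rv n)) V.
Proof. rewrite !(val_ren_as_sub _ rl'), val_sub_ren, val_ren_as_sub. reflexivity. Qed.

Lemma ren_up_val rl rt rv sv :
  (fun n => val_ren rl rt (up_ren rv) (up_val sv n))
  = up_val (fun n => val_ren rl rt rv (sv n)).
Proof. funext. rewrite !val_ren_ren. reflexivity. Qed.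

Lemma ren_sub :
  (forall V sl st sv rl rt rv, val_ren rl rt rv (val_sub sl st sv V)
     = val_sub (fun n => loc_ren rl (sl n)) (fun n => tty_ren rl rt (st n))
         (fun n => val_ren rl rt rv (sv n)) V)
  /\ (forall M sl st sv rl rt rv, tm_ren rl rt rv (tm_sub sl st sv M)
     = tm_sub (fun n => loc_ren rl (sl n)) (fun n => tty_ren rl rt (st n))
         (fun n => val_ren rl rt rv (sv n)) M).
Proof.
  apply val_tm_nested_ind; intros; simpl; f_equal;
    auto using tty_ren_sub; try apply loc_sub_comp.
  - map_tac.
  - map_tac. apply loc_sub_comp.
  - map_tac. apply tty_ren_sub.
  - rewrite H, ren_up_tty. f_equal. funext; rewrite !val_ren_ren; reflexivity.
  - rewrite H0, ren_up_val. reflexivity.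
  - rewrite H0, ren_up_val. reflexivity.
Qed.

Definition val_ren_sub := proj1 ren_sub.
Definition tm_ren_sub := proj2 ren_sub.

Lemma loc_ren_id_fun (s : nat -> loc) : (fun n => loc_ren id_ren (s n)) = s.
Proof. apply functional_extensionality; intro; apply loc_ren_id. Qed.

Lemma tty_ren_id A : tty_ren id_ren id_ren A = A.
Proof. rewrite tty_ren_as_sub. apply tty_sub_id. Qed.

Lemma tty_ren_id_fun (s : nat -> tty) :
  (fun n => tty_ren id_ren id_ren (s n)) = s.
Proof. apply functional_extensionality; intro; apply tty_ren_id. Qed.

Lemma up_val_comp sl st sv' sv :
  (fun n => val_sub sl st (up_val sv') (up_val sv n))
  = up_val (fun n => val_sub sl st sv' (sv n)).
Proof.
  funext. rewrite val_sub_ren, val_ren_sub, loc_ren_id_fun, tty_ren_id_fun.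
  reflexivity.
Qed.

Lemma val_sub_shift_ty sl st sv V :
  val_sub sl (up_tty st) (fun n => val_ren id_ren S id_ren (sv n))
    (val_ren id_ren S id_ren V)
  = val_ren id_ren S id_ren (val_sub sl st sv V).
Proof. rewrite val_sub_ren, val_ren_sub, loc_ren_id_fun. reflexivity. Qed.

Lemma val_sub_shift_loc sl st sv V :
  val_sub (up_loc sl) (fun n => tty_ren S id_ren (st n))
    (fun n => val_ren S id_ren id_ren (sv n)) (val_ren S id_ren id_ren V)
  = val_ren S id_ren id_ren (val_sub sl st sv V).
Proof. rewrite val_sub_ren, val_ren_sub. reflexivity. Qed.

Lemma sub_sub :
  (forall V sl st sv sl' st' sv', val_sub sl' st' sv' (val_sub sl st sv V)
     = val_sub (fun n => loc_sub sl' (sl n)) (fun n => tty_sub sl' st' (st n))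
         (fun n => val_sub sl' st' sv' (sv n)) V)
  /\ (forall M sl st sv sl' st' sv', tm_sub sl' st' sv' (tm_sub sl st sv M)
     = tm_sub (fun n => loc_sub sl' (sl n)) (fun n => tty_sub sl' st' (st n))
         (fun n => val_sub sl' st' sv' (sv n)) M).
Proof.
  apply val_tm_nested_ind; intros; simpl; f_equal;
    auto using tty_sub_sub, loc_sub_comp.
  - map_tac.
  - map_tac. apply loc_sub_comp.
  - map_tac. apply tty_sub_sub.
  - rewrite H, up_tty_comp. f_equal. funext; apply val_sub_shift_ty.
  - rewrite H0, up_val_comp. reflexivity.
  - rewrite H0, up_val_comp. reflexivity.
Qed.

Definition val_sub_sub := proj1 sub_sub.
Definition tm_sub_sub := proj2 sub_sub.

Lemma opencode_sub_sub O sl st sv sl' st' sv' :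
  opencode_sub sl' st' sv' (opencode_sub sl st sv O)
  = opencode_sub (fun n => loc_sub sl' (sl n)) (fun n => tty_sub sl' st' (st n))
      (fun n => val_sub sl' st' sv' (sv n)) O.
Proof.
  destruct O; simpl; f_equal.
  - rewrite tm_sub_sub, up_val_comp. reflexivity.
  - rewrite val_sub_sub, up_loc_comp. f_equal.
    + funext; apply tty_sub_shift_loc.
    + funext; apply val_sub_shift_loc.
Qed.

Lemma opencode_sub_id O : opencode_sub LV TyVar VVar O = O.
Proof.
  destruct O; simpl; f_equal.
  - rewrite up_val_id. apply tm_sub_id.
  - rewrite up_loc_id. apply val_sub_id.
Qed.

(** * Scoping of compiled code *)

Definition agree {X : Type} (n : nat) (s t : nat -> X) : Prop :=
  forall i, i < n -> s i = t i.

(* Scoping is expressed semantically: an expression depends on a substitution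
   only through the declared variables. *)
Definition ty_scoped (nl nt : nat) (A : tty) : Prop :=
  forall sl sl' st st', agree nl sl sl' -> agree nt st st' ->
    tty_sub sl st A = tty_sub sl' st' A.
Definition val_scoped (nl nt nv : nat) (V : val) : Prop :=
  forall sl sl' st st' sv sv',
    agree nl sl sl' -> agree nt st st' -> agree nv sv sv' ->
    val_sub sl st sv V = val_sub sl' st' sv' V.
Definition tm_scoped (nl nt nv : nat) (M : tm) : Prop :=
  forall sl sl' st st' sv sv',
    agree nl sl sl' -> agree nt st st' -> agree nv sv sv' ->
    tm_sub sl st sv M = tm_sub sl' st' sv' M.
Definition opencode_scoped (nl nt nv : nat) (O : opencode) : Prop :=
  forall sl sl' st st' sv sv',
    agree nl sl sl' -> agree nt st st' -> agree nv sv sv' ->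
    opencode_sub sl st sv O = opencode_sub sl' st' sv' O.

Definition wf_maps (P : fmaps) : Prop :=
  forall a F CT K, In (F, (CT, K)) (P a) ->
    ty_scoped (c_locs K) (c_tys K) (ct_body CT) /\
    opencode_scoped (c_locs K) (c_tys K) (c_vars K) (c_body K).

Lemma insts_map {X Y : Type} (f : X -> Y) (s : nat -> X) (t : nat -> Y) xs :
  agree (length xs) (fun n => f (insts xs s n)) (insts (map f xs) t).
Proof.
  induction xs as [|x xs IH]; intros i Hi; simpl in *; [lia|].
  destruct i as [|i]; simpl; [reflexivity|]. apply IH. lia.
Qed.

Lemma insts_map_seq {X : Type} (f : nat -> X) (s : nat -> X) n :
  agree n (insts (map f (seq 0 n)) s) f.
Proof.
  enough (H : forall n k i, i < n -> insts (map f (seq k n)) s i = f (k + i))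
    by (intros i Hi; apply (H n 0 i Hi)).
  clear n. induction n as [|n IH]; intros k i Hi; [lia|].
  destruct i as [|i]; simpl; [f_equal; lia|].
  change (insts (map f (seq (S k) n)) s i = f (k + S i)).
  rewrite IH by lia. f_equal. lia.
Qed.

(** Instantiating the code and then substituting amounts to instantiating it with the substituted
    lists. The two composite substitutions agree on the variables that the code declares
    ([insts_map]) but may differ beyond them; [wf_maps] says that nothing beyond them is read. *)
Lemma closure_code_sub P a Ws F Ls As T O sl st sv :
  wf_maps P ->
  closure_code (P a) Ws F Ls As T O ->
  closure_code (P a) (map (val_sub sl st sv) Ws) F
    (map (loc_sub sl) Ls) (map (tty_sub sl st) As)
    (tty_sub sl st T) (opencode_sub sl st sv O).
Proof.
  intros HP (CT & K & Hin & Hl & Ht & Hv & -> & ->).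
  exists CT, K. rewrite !length_map. repeat split; auto.
  - rewrite tty_sub_sub. apply (proj1 (HP _ _ _ _ Hin)).
    + rewrite <- Hl. apply insts_map.
    + rewrite <- Ht. apply insts_map.
  - rewrite opencode_sub_sub. apply (proj2 (HP _ _ _ _ Hin)).
    + rewrite <- Hl. apply insts_map.
    + rewrite <- Ht. apply insts_map.
    + rewrite <- Hv. apply insts_map.
Qed.

(** * Scoping of the compiler's output *)

Definition env_ok (G : env) : Prop := Forall (sty_ok G) (e_vars G).
Definition env_scoped (G : env) : val -> Prop :=
  val_scoped (e_locs G) (e_tys G) (length (e_vars G)).
Definition env_tm_scoped (G : env) : tm -> Prop :=
  tm_scoped (e_locs G) (e_tys G) (length (e_vars G)).

Lemma loc_scoped nl L sl sl' :
  loc_in nl L -> agree nl sl sl' -> loc_sub sl L = loc_sub sl' L.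
Proof. destruct L; simpl; auto. Qed.

Lemma agree_up {X : Type} n (f : X -> X) (x : X) s t :
  agree n s t ->
  agree (S n) (scons x (fun i => f (s i))) (scons x (fun i => f (t i))).
Proof.
  intros H [|i] Hi; simpl; [reflexivity|]. rewrite H by lia. reflexivity.
Qed.

Lemma agree_map {X Y : Type} n (f : X -> Y) s t :
  agree n s t -> agree n (fun i => f (s i)) (fun i => f (t i)).
Proof. intros H i Hi. rewrite H by lia. reflexivity. Qed.

Lemma vty_scoped A : forall nl nt, sty_in nl nt A -> ty_scoped nl nt (vty A).
Proof.
  induction A; intros nl nt HA sl sl' st st' Hl Ht; simpl in *; auto.
  - destruct HA as (H1 & H2 & H3).
    rewrite (IHA1 _ _ H1 sl sl' st st'), (IHA2 _ _ H3 sl sl' st st'),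
      (loc_scoped nl L sl sl') by auto.
    reflexivity.
  - destruct HA as (H1 & H2).
    rewrite (IHA1 _ _ H1 sl sl' st st'), (IHA2 _ _ H2 sl sl' st st') by auto.
    reflexivity.
  - do 2 f_equal. eapply IHA; eauto. apply agree_up, Ht.
  - do 3 f_equal. eapply IHA; eauto; [apply agree_up, Hl | apply agree_map, Ht].
Qed.

Lemma loc_in_sub nl nl' sl L :
  loc_in nl L -> (forall l, l < nl -> loc_in nl' (sl l)) ->
  loc_in nl' (loc_sub sl L).
Proof. destruct L; simpl; auto. Qed.

Lemma up_ren_lt n n' r :
  (forall i, i < n -> r i < n') -> forall i, i < S n -> up_ren r i < S n'.
Proof. intros H [|i] Hi; simpl; [lia|]. specialize (H i). lia. Qed.

Lemma sty_in_ren A : forall nl nt nl' nt' rl rt,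
  sty_in nl nt A ->
  (forall l, l < nl -> rl l < nl') -> (forall n, n < nt -> rt n < nt') ->
  sty_in nl' nt' (sty_ren rl rt A).
Proof.
  induction A; intros nl nt nl' nt' rl rt HA Hl Ht; simpl in *; auto.
  - destruct HA as (H1 & H2 & H3). repeat split; eauto.
    eapply loc_in_sub; eauto.
  - destruct HA. split; eauto.
  - eapply IHA; eauto using up_ren_lt.
  - eapply IHA; eauto using up_ren_lt.
Qed.

Lemma up_loc_in nl nl' sl :
  (forall l, l < nl -> loc_in nl' (sl l)) ->
  forall l, l < S nl -> loc_in (S nl') (up_loc sl l).
Proof.
  intros H [|l] Hl; simpl; [lia|].
  eapply loc_in_sub; [apply H; lia|]. simpl. lia.
Qed.

Lemma up_sty_in nl nt nt' st :
  (forall n, n < nt -> sty_in nl nt' (st n)) ->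
  forall n, n < S nt -> sty_in nl (S nt') (up_sty st n).
Proof.
  intros H [|n] Hn; simpl; [lia|].
  eapply sty_in_ren; [apply H; lia| |]; unfold id_ren; intros; lia.
Qed.

Lemma shift_loc_sty_in nl nt A :
  sty_in nl nt A -> sty_in (S nl) nt (sty_ren S id_ren A).
Proof. intro H. eapply sty_in_ren; eauto; unfold id_ren; intros; lia. Qed.

Lemma shift_ty_sty_in nl nt A :
  sty_in nl nt A -> sty_in nl (S nt) (sty_ren id_ren S A).
Proof. intro H. eapply sty_in_ren; eauto; unfold id_ren; intros; lia. Qed.

Lemma sty_in_sub A : forall nl nt nl' nt' sl st,
  sty_in nl nt A ->
  (forall l, l < nl -> loc_in nl' (sl l)) ->
  (forall n, n < nt -> sty_in nl' nt' (st n)) ->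
  sty_in nl' nt' (sty_sub sl st A).
Proof.
  induction A; intros nl nt nl' nt' sl st HA Hl Ht; simpl in *; auto.
  - destruct HA as (H1 & H2 & H3). repeat split; eauto.
    eapply loc_in_sub; eauto.
  - destruct HA. split; eauto.
  - eapply IHA; eauto using up_sty_in.
  - eapply IHA; eauto using up_loc_in, shift_loc_sty_in.
Qed.

Lemma env_ok_var G A : env_ok G -> sty_ok G A -> env_ok (env_var G A).
Proof. intros HG HA. constructor; auto. Qed.

Lemma env_ok_ty G : env_ok G -> env_ok (env_ty G).
Proof. intro HG. apply Forall_map. eapply Forall_impl, HG. apply shift_ty_sty_in. Qed.

Lemma env_ok_loc G : env_ok G -> env_ok (env_loc G).
Proof. intro HG. apply Forall_map. eapply Forall_impl, HG. apply shift_loc_sty_in. Qed.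

Scheme vcomp_mut := Minimality for vcomp Sort Prop
with ccomp_mut := Minimality for ccomp Sort Prop.
Combined Scheme comp_mutind from vcomp_mut, ccomp_mut.

Lemma tm_scoped_up nl nt nv N sl sl' st st' sv sv' :
  tm_scoped nl nt (S nv) N ->
  agree nl sl sl' -> agree nt st st' -> agree nv sv sv' ->
  tm_sub sl st (up_val sv) N = tm_sub sl' st' (up_val sv') N.
Proof. intros H Hl Ht Hv. apply H; auto. apply agree_up, Hv. Qed.

Lemma tm_sub_shift1 sl st sv N :
  tm_sub sl st (up_val sv) (shift1 N) = shift1 (tm_sub sl st sv N).
Proof.
  unfold shift1. rewrite tm_sub_ren, tm_ren_sub, loc_ren_id_fun, tty_ren_id_fun.
  reflexivity.
Qed.

Lemma tm_sub_scons_shift1 V N : tm_sub LV TyVar (scons V VVar) (shift1 N) = N.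
Proof. unfold shift1. rewrite tm_sub_ren. apply tm_sub_id. Qed.

Lemma val_sub_scons_shift V W :
  val_sub LV TyVar (scons V VVar) (val_ren id_ren id_ren S W) = W.
Proof. rewrite val_sub_ren. apply val_sub_id. Qed.

Lemma env_closure_scoped G F : env_scoped G (env_closure G F).
Proof.
  intros sl sl' st st' sv sv' Hl Ht Hv. unfold env_closure; simpl.
  rewrite !map_map. f_equal; apply map_ext_in; intros i Hi;
    apply in_seq in Hi; simpl; [apply Hv | apply Hl | apply Ht]; lia.
Qed.

Lemma wf_join P Q : wf_maps P -> wf_maps Q -> wf_maps (join P Q).
Proof.
  intros HP HQ a F CT K Hin. apply in_app_or in Hin as [|]; eauto.
Qed.

Lemma wf_add_code L F CT K P :
  wf_maps P ->
  ty_scoped (c_locs K) (c_tys K) (ct_body CT) ->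
  opencode_scoped (c_locs K) (c_tys K) (c_vars K) (c_body K) ->
  wf_maps (add_code L F CT K P).
Proof.
  intros HP HT HO a F' CT' K' Hin. unfold add_code in Hin.
  destruct (hosted_dec L a); [destruct Hin as [[= <- <- <-]|]|]; eauto.
Qed.

Lemma wf_add_code_both F CT K P :
  wf_maps P ->
  ty_scoped (c_locs K) (c_tys K) (ct_body CT) ->
  opencode_scoped (c_locs K) (c_tys K) (c_vars K) (c_body K) ->
  wf_maps (add_code_both F CT K P).
Proof.
  intros HP HT HO a F' CT' K' [[= <- <- <-]|Hin]; eauto.
Qed.

(** Indices 1 and 0 are the function and the argument bound by the two enclosing [do]s. The branch
    is chosen before any substitution, and of the two locations only [L'] can occur in the result,
    inside a [gen]. *)
Lemma invoke_scoped nl nt nv L L' :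
  loc_in nl L' -> tm_scoped nl nt (S (S nv)) (invoke L L' (VVar 1) (VVar 0)).
Proof.
  intros HL' sl sl' st st' sv sv' Hl Ht Hv.
  assert (E0 : sv 0 = sv' 0) by (apply Hv; lia).
  assert (E1 : sv 1 = sv' 1) by (apply Hv; lia).
  unfold invoke. destruct (loc_eq_dec L L'); simpl; [congruence|].
  destruct L as [[|]|l], L' as [[|]|l']; simpl; rewrite ?E0, ?E1;
    try rewrite (Hl _ HL'); reflexivity.
Qed.

Lemma lam_scoped nl nt nv N :
  tm_scoped nl nt (S nv) N -> opencode_scoped nl nt nv (OLam N).
Proof.
  intros H sl sl' st st' sv sv' Hl Ht Hv. simpl. f_equal.
  eapply tm_scoped_up; eauto.
Qed.

Lemma llam_scoped nl nt nv V :
  val_scoped (S nl) nt nv V -> opencode_scoped nl nt nv (OLLam V).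
Proof.
  intros H sl sl' st st' sv sv' Hl Ht Hv. simpl. f_equal.
  apply H; [apply agree_up, Hl | apply agree_map, Ht | apply agree_map, Hv].
Qed.

Lemma arr_scoped nl nt A L B :
  sty_in nl nt A -> loc_in nl L -> sty_in nl nt B ->
  ty_scoped nl nt (TyArr (vty A) L (cty B)).
Proof.
  intros HA HL HB sl sl' st st' Hl Ht. simpl.
  rewrite (vty_scoped _ _ _ HA sl sl' st st'),
    (vty_scoped _ _ _ HB sl sl' st st'), (loc_scoped nl L sl sl') by auto.
  reflexivity.
Qed.

Lemma all_loc_scoped nl nt A :
  sty_in (S nl) nt A -> ty_scoped nl nt (TyAllL (cty A)).
Proof.
  intros HA sl sl' st st' Hl Ht. simpl. do 2 f_equal.
  apply (vty_scoped _ _ _ HA); [apply agree_up, Hl | apply agree_map, Ht].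
Qed.

Lemma unit_llam_scoped G W :
  env_scoped (env_loc G) W ->
  opencode_scoped (e_locs G) (e_tys G) (length (e_vars G)) (OLLam (VUnit W)).
Proof.
  intro HW. apply llam_scoped. unfold env_scoped in HW. simpl in HW.
  rewrite length_map in HW.
  intros sl sl' st st' sv sv' Hl Ht Hv. simpl. f_equal. apply HW; auto.
Qed.

(** The three conclusions need each other: a new binding is well formed because the compiled body is
    scoped and because the result type, which enters the code type, is well scoped. The closure
    itself mentions exactly the declared variables. *)
Lemma comp_scoped :
  (forall G L M A W P, vcomp G L M A W P -> env_ok G ->
     env_scoped G W /\ sty_ok G A /\ wf_maps P) /\
  (forall G L M A N P, ccomp G L M A N P -> env_ok G ->
     env_tm_scoped G N /\ sty_ok G A /\ wf_maps P).
Proof.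
  apply comp_mutind.
  - intros G L n A Hn HG. split; [|split; [|intros a F CT K []]].
    + intros sl sl' st st' sv sv' _ _ Hv. apply Hv.
      apply nth_error_Some. congruence.
    + apply nth_error_In in Hn. unfold env_ok in HG. rewrite Forall_forall in HG.
      auto.
  - intros G L L' M A B N F P HL' HA _ IH HF HG.
    destruct (IH (env_ok_var _ _ HG HA)) as (HN & HB & HP).
    refine (conj _ (conj (conj _ (conj _ _)) _)); auto using env_closure_scoped.
    apply wf_add_code; auto.
    + apply arr_scoped; auto.
    + apply lam_scoped, HN.
  - intros G L V A W F P _ IH HF HG.
    destruct (IH (env_ok_loc _ HG)) as (HW & HA & HP).
    refine (conj _ (conj _ _)); auto using env_closure_scoped.
    apply wf_add_code_both; auto.
    + apply all_loc_scoped, HA.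
    + apply unit_llam_scoped, HW.
  - intros G L V A W P _ IH HG.
    destruct (IH (env_ok_ty _ HG)) as (HW & HA & HP).
    refine (conj _ (conj _ _)); auto.
    unfold env_scoped in HW. simpl in HW. rewrite length_map in HW.
    intros sl sl' st st' sv sv' Hl Ht Hv. simpl. do 2 f_equal.
    apply HW; [apply Hl | apply agree_up, Ht | apply agree_map, Hv].
  - intros G L V1 V2 A1 A2 W1 W2 P1 P2 _ IH1 _ IH2 _ HG.
    destruct (IH1 HG) as (HW1 & HA1 & HP1), (IH2 HG) as (HW2 & HA2 & HP2).
    refine (conj _ (conj (conj HA1 HA2) _)); auto using wf_join.
    intros sl sl' st st' sv sv' Hl Ht Hv. simpl. f_equal; [apply HW1|apply HW2]; auto.
  - intros G L V A W P _ IH HG. destruct (IH HG) as (HW & HA & HP).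
    refine (conj _ (conj _ _)); auto.
    intros sl sl' st st' sv sv' Hl Ht Hv. simpl. do 2 f_equal. apply HW; auto.
  - intros G L L' M1 M2 A B N1 N2 P1 P2 _ IH1 _ IH2 _ HG.
    destruct (IH1 HG) as (HN1 & (HA & HL' & HB) & HP1), (IH2 HG) as (HN2 & _ & HP2).
    refine (conj _ (conj _ _)); auto using wf_join.
    intros sl sl' st st' sv sv' Hl Ht Hv. simpl. rewrite !tm_sub_shift1.
    do 2 f_equal; [apply HN1; auto|]. do 2 f_equal; [f_equal; apply HN2; auto|].
    eapply invoke_scoped; eauto. apply agree_up, agree_up, Hv.
  - intros G L M A B N P HB _ IH HG. destruct (IH HG) as (HN & HA & HP).
    refine (conj _ (conj _ _)); auto.
    + intros sl sl' st st' sv sv' Hl Ht Hv. simpl. do 2 f_equal; [apply HN; auto|].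
      f_equal. eapply vty_scoped; eauto.
    + eapply sty_in_sub; [exact HA| |]; [intros l Hl; exact Hl|].
      intros [|n] Hn; simpl; [exact HB | lia].
  - intros G L L' M A N P HL' _ IH HG. destruct (IH HG) as (HN & HA & HP).
    refine (conj _ (conj _ _)); auto.
    + intros sl sl' st st' sv sv' Hl Ht Hv. simpl. do 2 f_equal; [apply HN; auto|].
      f_equal. eapply loc_scoped; eauto.
    + eapply sty_in_sub; [exact HA| |]; [|intros n Hn; exact Hn].
      intros [|l] Hl; simpl; [exact HL' | lia].
  - intros G L M1 M2 A1 A2 N1 N2 P1 P2 _ _ IH1 _ IH2 _ HG.
    destruct (IH1 HG) as (HN1 & HA1 & HP1), (IH2 HG) as (HN2 & HA2 & HP2).
    refine (conj _ (conj (conj HA1 HA2) _)); auto using wf_join.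
    intros sl sl' st st' sv sv' Hl Ht Hv. simpl. rewrite !tm_sub_shift1.
    do 2 f_equal; [apply HN1; auto|]. do 3 f_equal. apply HN2; auto.
  - intros G L i M A1 A2 N P _ IH HG. destruct (IH HG) as (HN & (HA1 & HA2) & HP).
    refine (conj _ (conj _ _)); auto.
    + intros sl sl' st st' sv sv' Hl Ht Hv. simpl. do 2 f_equal. apply HN; auto.
    + destruct i; auto.
Qed.

(** * The run-time compilation relation *)

(* At run time, code compiled for an unknown target location has been
   instantiated but not yet dispatched. *)
Definition dispatched (L L' : loc) (V W : val) (N : tm) : Prop :=
  N = invoke L L' V W \/ N = TVal (VGen L' V W).

(** Values carry no location here, so a result obtained at one site may be used at the other. The
    closure clauses constrain only the instantiated code: [G] is the scope of the source value and
    need not be the environment over which the closure was built. *)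
Inductive rvcomp (P : fmaps) : env -> stm -> sty -> val -> Prop :=
| rv_var G n A :
    nth_error (e_vars G) n = Some A ->
    rvcomp P G (SVar n) A (VVar n)
| rv_lam G L' M A B Ws F Ls As N :
    loc_ok G L' -> sty_ok G A ->
    (forall a, hosted L' a ->
       closure_code (P a) Ws F Ls As (TyArr (vty A) L' (cty B)) (OLam N)) ->
    rcomp P (env_var G A) L' M B N ->
    rvcomp P G (SLam L' M) (SArr A L' B) (VClo Ws F Ls As)
| rv_llam G V A Ws F Ls As W :
    (forall a,
       closure_code (P a) Ws F Ls As (TyAllL (cty A)) (OLLam (VUnit W))) ->
    rvcomp P (env_loc G) V A W ->
    rvcomp P G (SLLam V) (SAllL A) (VClo Ws F Ls As)
| rv_tlam G V A W :
    rvcomp P (env_ty G) V A W ->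
    rvcomp P G (STLam V) (SAllT A) (VTLam (VUnit W))
| rv_pair G V1 V2 A1 A2 W1 W2 :
    rvcomp P G V1 A1 W1 ->
    rvcomp P G V2 A2 W2 ->
    rvcomp P G (SPair V1 V2) (SProd A1 A2) (VPair W1 W2)
with rcomp (P : fmaps) : env -> loc -> stm -> sty -> tm -> Prop :=
| rc_val G L V A W :
    rvcomp P G V A W ->
    rcomp P G L V A (TVal (VUnit W))
| rc_app G L L' M1 M2 A B N1 N2 X :
    rcomp P G L M1 (SArr A L' B) N1 ->
    rcomp P G L M2 A N2 ->
    dispatched L L' (VVar 1) (VVar 0) X ->
    rcomp P G L (SApp M1 M2) B (TVal (VDo N1 (TVal (VDo (shift1 N2) X))))
| rc_tapp G L M A B N :
    sty_ok G B ->
    rcomp P G L M (SAllT A) N ->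
    rcomp P G L (STApp M B) (sty_sub LV (scons B STVar) A)
      (TVal (VDo N (TTApp (VVar 0) (vty B))))
| rc_lapp G L L' M A N :
    loc_ok G L' ->
    rcomp P G L M (SAllL A) N ->
    rcomp P G L (SLApp M L') (sty_sub (scons L' LV) STVar A)
      (TVal (VDo N (TLApp (VVar 0) L')))
| rc_pair G L M1 M2 A1 A2 N1 N2 :
    ~ svalue (SPair M1 M2) ->
    rcomp P G L M1 A1 N1 ->
    rcomp P G L M2 A2 N2 ->
    rcomp P G L (SPair M1 M2) (SProd A1 A2)
      (TVal (VDo N1 (TVal (VDo (shift1 N2)
         (TVal (VUnit (VPair (VVar 1) (VVar 0))))))))
| rc_proj G L i M A1 A2 N :
    rcomp P G L M (SProd A1 A2) N ->
    rcomp P G L (SProj i M) (pick i A1 A2)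
      (TVal (VDo N (TLet (TProj i (VVar 0)) (TVal (VUnit (VVar 0)))))).

Scheme rvcomp_mut := Minimality for rvcomp Sort Prop
with rcomp_mut := Minimality for rcomp Sort Prop.
Combined Scheme rcomp_mutind from rvcomp_mut, rcomp_mut.

Definition sub_maps (P Q : fmaps) : Prop := forall a, incl (P a) (Q a).

Lemma sub_maps_join_l P Q R : sub_maps (join P Q) R -> sub_maps P R.
Proof. intros H a x Hx. apply H, in_or_app. auto. Qed.

Lemma sub_maps_join_r P Q R : sub_maps (join P Q) R -> sub_maps Q R.
Proof. intros H a x Hx. apply H, in_or_app. auto. Qed.

Lemma sub_maps_add_code L F CT K P Q :
  sub_maps (add_code L F CT K P) Q ->
  sub_maps P Q /\ forall a, hosted L a -> In (F, (CT, K)) (Q a).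
Proof.
  intro H. split.
  - intros a x Hx. apply H. unfold add_code.
    destruct (hosted_dec L a); simpl; auto.
  - intros a Ha. apply H. unfold add_code.
    destruct (hosted_dec L a); simpl; [auto | contradiction].
Qed.

Lemma sub_maps_add_code_both F CT K P Q :
  sub_maps (add_code_both F CT K P) Q ->
  sub_maps P Q /\ forall a, In (F, (CT, K)) (Q a).
Proof.
  intro H. split; [intros a x Hx | intros a]; apply H; simpl; auto.
Qed.

(** A freshly built closure instantiates each declared variable by itself. Past the end of its list
    [insts] restarts at index 0 of its tail, so it is the identity only below the declared bounds;
    scoping of [T] and [O] closes the gap. *)
Lemma env_closure_code P G F T O :
  ty_scoped (e_locs G) (e_tys G) T ->
  opencode_scoped (e_locs G) (e_tys G) (length (e_vars G)) O ->
  In (F, (env_codety G T, env_code G O)) P ->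
  closure_code P (map VVar (seq 0 (length (e_vars G)))) F
    (map LV (seq 0 (e_locs G))) (map TyVar (seq 0 (e_tys G))) T O.
Proof.
  intros HT HO Hin. exists (env_codety G T), (env_code G O).
  rewrite !length_map, !length_seq. repeat split; auto; symmetry.
  - rewrite <- (tty_sub_id T) at 2. apply HT; apply insts_map_seq.
  - rewrite <- (opencode_sub_id O) at 2. apply HO; apply insts_map_seq.
Qed.

(** Each subderivation generates only a part of the maps, whereas code runs with the complete ones.
    [Q] is therefore fixed throughout, and the generated part is only required to be included in
    it. *)
Lemma comp_rcomp Q :
  (forall G L M A W P, vcomp G L M A W P -> env_ok G -> sub_maps P Q ->
     rvcomp Q G M A W) /\
  (forall G L M A N P, ccomp G L M A N P -> env_ok G -> sub_maps P Q ->
     rcomp Q G L M A N).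
Proof.
  apply comp_mutind; intros.
  - constructor; auto.
  - destruct (sub_maps_add_code _ _ _ _ _ _ H5) as [HP HF].
    assert (HG := env_ok_var _ _ H4 H0).
    destruct (proj2 comp_scoped _ _ _ _ _ _ H1 HG) as (HN & HB & _).
    apply rv_lam with (N := N); auto. intros a Ha. apply env_closure_code; auto.
    + apply arr_scoped; auto.
    + apply lam_scoped, HN.
  - destruct (sub_maps_add_code_both _ _ _ _ _ H3) as [HP HF].
    assert (HG := env_ok_loc _ H2).
    destruct (proj1 comp_scoped _ _ _ _ _ _ H HG) as (HW & HA & _).
    apply rv_llam with (W := W); auto. intros a. apply env_closure_code; auto.
    + apply all_loc_scoped; auto.
    + apply unit_llam_scoped, HW.
  - constructor. auto using env_ok_ty.
  - constructor; eauto using sub_maps_join_l, sub_maps_join_r.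
  - constructor; auto.
  - econstructor; eauto using sub_maps_join_l, sub_maps_join_r. left; reflexivity.
  - constructor; auto.
  - constructor; auto.
  - constructor; eauto using sub_maps_join_l, sub_maps_join_r.
  - econstructor; auto.
Qed.

(** * Substitution in run-time compilations *)

Lemma up_stm_var r : up_stm (fun n => SVar (r n)) = fun n => SVar (up_ren r n).
Proof. funext. Qed.

Lemma stm_ren_as_sub M : forall rl rt rv,
  stm_ren rl rt rv M
  = stm_sub (fun n => LV (rl n)) (fun n => STVar (rt n)) (fun n => SVar (rv n)) M.
Proof.
  induction M; intros; simpl; f_equal; auto using sty_ren_as_sub.
  - rewrite IHM, up_stm_var. reflexivity.
  - rewrite IHM, up_sty_var. reflexivity.
  - rewrite IHM, up_loc_var. reflexivity.
Qed.

(** Substitution changes the head of a term only at a variable, which is a value already. This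
    preserves the side condition of [rc_pair]. *)
Lemma svalue_sub_inv M : forall sl st sv, svalue (stm_sub sl st sv M) -> svalue M.
Proof.
  induction M; intros sl st sv H; simpl in H; try (inversion H; fail);
    try constructor; inversion H; subst; eauto.
Qed.

(** An [invoke] between equal locations or between two sites has its final form, which substitution
    keeps. In every other case it is a [gen] and stays a [gen], even when the new locations would
    select another form; the second disjunct of [dispatched] absorbs this. *)
Lemma dispatched_sub sl st sv L L' V W N :
  dispatched L L' V W N ->
  dispatched (loc_sub sl L) (loc_sub sl L')
    (val_sub sl st sv V) (val_sub sl st sv W) (tm_sub sl st sv N).
Proof.
  intros [->| ->]; [|right; reflexivity].
  unfold invoke. destruct (loc_eq_dec L L') as [->|HL].
  - left. unfold invoke. destruct loc_eq_dec; [reflexivity | congruence].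
  - destruct L as [[|]|l], L' as [[|]|l']; try (right; reflexivity); left;
      reflexivity || congruence.
Qed.

Lemma sty_sub_ty_comm sl st B A :
  sty_sub sl st (sty_sub LV (scons B STVar) A)
  = sty_sub LV (scons (sty_sub sl st B) STVar) (sty_sub sl (up_sty st) A).
Proof.
  rewrite !sty_sub_sub. f_equal.
  - apply functional_extensionality; intro. symmetry. apply loc_sub_id.
  - funext. rewrite sty_sub_ren. symmetry. apply sty_sub_id.
Qed.

Lemma sty_sub_loc_comm sl st L A :
  sty_sub sl st (sty_sub (scons L LV) STVar A)
  = sty_sub (scons (loc_sub sl L) LV) STVar
      (sty_sub (up_loc sl) (fun n => sty_ren S id_ren (st n)) A).
Proof.
  rewrite !sty_sub_sub. f_equal.
  - funext. unfold loc_ren. rewrite loc_sub_comp. symmetry. apply loc_sub_id.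
  - funext; rewrite sty_sub_ren; symmetry; apply sty_sub_id.
Qed.

Lemma sty_sub_shift_ty sl st A :
  sty_sub sl (up_sty st) (sty_ren id_ren S A) = sty_ren id_ren S (sty_sub sl st A).
Proof.
  rewrite sty_sub_ren, sty_ren_sub. f_equal.
  apply functional_extensionality; intro. symmetry. apply loc_ren_id.
Qed.

Lemma sty_sub_shift_loc sl st A :
  sty_sub (up_loc sl) (fun n => sty_ren S id_ren (st n)) (sty_ren S id_ren A)
  = sty_ren S id_ren (sty_sub sl st A).
Proof. rewrite sty_sub_ren, sty_ren_sub. reflexivity. Qed.

Lemma sty_sub_pick sl st i A1 A2 :
  sty_sub sl st (pick i A1 A2) = pick i (sty_sub sl st A1) (sty_sub sl st A2).
Proof. destruct i; reflexivity. Qed.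

(* Renamings and substitutions of values are both instances of this lemma: [OK]
   is any class of typed simultaneous substitutions that is stable under
   binders. *)
Lemma rcomp_traverse P
  (OK : env -> env -> (nat -> loc) -> (nat -> sty) -> (nat -> stm) ->
        (nat -> val) -> Prop) :
  wf_maps P ->
  (forall G G' sl st sv tv, OK G G' sl st sv tv ->
     (forall l, l < e_locs G -> loc_ok G' (sl l)) /\
     (forall n, n < e_tys G -> sty_ok G' (st n)) /\
     (forall n A, nth_error (e_vars G) n = Some A ->
        rvcomp P G' (sv n) (sty_sub sl st A) (tv n))) ->
  (forall G G' sl st sv tv A, OK G G' sl st sv tv ->
     OK (env_var G A) (env_var G' (sty_sub sl st A)) sl st
       (up_stm sv) (up_val tv)) ->
  (forall G G' sl st sv tv, OK G G' sl st sv tv ->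
     OK (env_ty G) (env_ty G') sl (up_sty st)
       (fun n => stm_ren id_ren S id_ren (sv n))
       (fun n => val_ren id_ren S id_ren (tv n))) ->
  (forall G G' sl st sv tv, OK G G' sl st sv tv ->
     OK (env_loc G) (env_loc G') (up_loc sl) (fun n => sty_ren S id_ren (st n))
       (fun n => stm_ren S id_ren id_ren (sv n))
       (fun n => val_ren S id_ren id_ren (tv n))) ->
  (forall G V A W, rvcomp P G V A W ->
     forall G' sl st sv tv, OK G G' sl st sv tv ->
     rvcomp P G' (stm_sub sl st sv V) (sty_sub sl st A)
       (val_sub sl (fun n => vty (st n)) tv W)) /\
  (forall G L M A N, rcomp P G L M A N ->
     forall G' sl st sv tv, OK G G' sl st sv tv ->
     rcomp P G' (loc_sub sl L) (stm_sub sl st sv M) (sty_sub sl st A)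
       (tm_sub sl (fun n => vty (st n)) tv N)).
Proof.
  intros HP Hok Hvar Hty Hloc. apply rcomp_mutind.
  - intros G n A Hn G' sl st sv tv H. simpl. eapply Hok; eauto.
  - intros G L' M A B Ws F Ls As N HL HA HC _ IH G' sl st sv tv H. simpl.
    destruct (Hok _ _ _ _ _ _ H) as (Hl & Ht & _).
    econstructor.
    + eapply loc_in_sub; eauto.
    + eapply sty_in_sub; eauto.
    (* The code follows the substituted closure, and [vty_sub] turns its code type into that of the
       substituted source type. *)
    + intros a Ha.
      apply (closure_code_sub P a Ws F Ls As _ _ sl (fun n => vty (st n)) tv) in HC;
        [|exact HP | destruct L'; simpl in *; auto].
      simpl in HC. rewrite <- !vty_sub in HC. exact HC.
    + apply IH. apply Hvar, H.
  - intros G V A Ws F Ls As W HC _ IH G' sl st sv tv H. simpl.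
    specialize (IH _ _ _ _ _ (Hloc _ _ _ _ _ _ H)).
    (* The induction hypothesis shifts types before compiling them, [closure_code_sub] after. *)
    assert (E : (fun n => vty (sty_ren S id_ren (st n)))
                = fun n => tty_ren S id_ren (vty (st n)))
      by (apply functional_extensionality; intro; apply vty_ren).
    econstructor; [|exact IH]. intros a. specialize (HC a).
    apply (closure_code_sub P a Ws F Ls As _ _ sl (fun n => vty (st n)) tv) in HC;
      [|exact HP].
    simpl in HC. rewrite <- E, <- vty_sub in HC. exact HC.
  - intros G V A W _ IH G' sl st sv tv H. simpl. constructor.
    specialize (IH _ _ _ _ _ (Hty _ _ _ _ _ _ H)). rewrite vty_up in IH. exact IH.
  - intros. simpl. constructor; auto.
  - intros. simpl. constructor; auto.
  - intros G L L' M1 M2 A B N1 N2 X _ IH1 _ IH2 HX G' sl st sv tv H. simpl.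
    rewrite tm_sub_shift1. eapply rc_app.
    + apply IH1, H.
    + apply IH2, H.
    + apply (dispatched_sub sl (fun n => vty (st n)) (up_val (up_val tv))) in HX.
      exact HX.
  - intros G L M A B N HB _ IH G' sl st sv tv H. simpl.
    destruct (Hok _ _ _ _ _ _ H) as (Hl & Ht & _).
    rewrite sty_sub_ty_comm, <- vty_sub. constructor.
    + eapply sty_in_sub; eauto.
    + apply IH, H.
  - intros G L L' M A N HL' _ IH G' sl st sv tv H. simpl.
    destruct (Hok _ _ _ _ _ _ H) as (Hl & Ht & _).
    rewrite sty_sub_loc_comm. constructor.
    + eapply loc_in_sub; eauto.
    + apply IH, H.
  - intros G L M1 M2 A1 A2 N1 N2 Hnv _ IH1 _ IH2 G' sl st sv tv H. simpl.
    rewrite tm_sub_shift1. constructor; auto.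
    intro Hv. apply Hnv. apply (svalue_sub_inv (SPair M1 M2) sl st sv), Hv.
  - intros G L i M A1 A2 N _ IH G' sl st sv tv H. simpl.
    rewrite sty_sub_pick. constructor. apply IH, H.
Qed.

Definition typed_ren (G G' : env) (rl rt rv : nat -> nat) : Prop :=
  (forall l, l < e_locs G -> rl l < e_locs G') /\
  (forall n, n < e_tys G -> rt n < e_tys G') /\
  (forall n A, nth_error (e_vars G) n = Some A ->
     nth_error (e_vars G') (rv n) = Some (sty_ren rl rt A)).

Lemma nth_error_map_some {X Y : Type} (f : X -> Y) l n y :
  nth_error (map f l) n = Some y ->
  exists x, nth_error l n = Some x /\ y = f x.
Proof.
  rewrite nth_error_map. destruct (nth_error l n) as [x|]; intros [= <-]. eauto.
Qed.

(** Renamings come before substitutions: lifting a substitution under a binder shifts the related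
    pairs of values that it contains, and this instance justifies the shift. *)
Lemma rvcomp_ren P G V A W G' rl rt rv :
  wf_maps P -> rvcomp P G V A W -> typed_ren G G' rl rt rv ->
  rvcomp P G' (stm_ren rl rt rv V) (sty_ren rl rt A) (val_ren rl rt rv W).
Proof.
  intros HP HV HR. rewrite stm_ren_as_sub, sty_ren_as_sub, val_ren_as_sub.
  refine (proj1 (rcomp_traverse P
    (fun G G' sl st sv tv => exists rl rt rv, typed_ren G G' rl rt rv /\
       sl = (fun n => LV (rl n)) /\ st = (fun n => STVar (rt n)) /\
       sv = (fun n => SVar (rv n)) /\ tv = (fun n => VVar (rv n)))
    HP _ _ _ _) _ _ _ _ HV _ _ _ _ _ _);
    [..|exists rl, rt, rv; auto]; clear.
  - intros G G' sl st sv tv (rl & rt & rv & (Hl & Ht & Hv) & -> & -> & -> & ->).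
    split; [exact Hl | split; [exact Ht |]].
    intros n A Hn. rewrite <- sty_ren_as_sub. constructor. auto.
  - intros G G' sl st sv tv A (rl & rt & rv & (Hl & Ht & Hv) & -> & -> & -> & ->).
    exists rl, rt, (up_ren rv). rewrite up_stm_var, up_val_var.
    split; [|auto]. split; [exact Hl | split; [exact Ht |]].
    intros [|n] B Hn; simpl in *.
    + rewrite <- sty_ren_as_sub. congruence.
    + auto.
  - intros G G' sl st sv tv (rl & rt & rv & (Hl & Ht & Hv) & -> & -> & -> & ->).
    exists rl, (up_ren rt), rv. rewrite up_sty_var.
    split; [|auto]. split; [exact Hl | split; [apply up_ren_lt, Ht |]].
    intros n B Hn. apply nth_error_map_some in Hn as (A & Hn & ->).
    simpl. rewrite nth_error_map, (Hv _ _ Hn). simpl.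
    rewrite !sty_ren_ren. reflexivity.
  - intros G G' sl st sv tv (rl & rt & rv & (Hl & Ht & Hv) & -> & -> & -> & ->).
    exists (up_ren rl), rt, rv. rewrite up_loc_var.
    split; [|auto]. split; [apply up_ren_lt, Hl | split; [exact Ht |]].
    intros n B Hn. apply nth_error_map_some in Hn as (A & Hn & ->).
    simpl. rewrite nth_error_map, (Hv _ _ Hn). simpl.
    rewrite !sty_ren_ren. reflexivity.
Qed.

Lemma sty_ren_id A : sty_ren id_ren id_ren A = A.
Proof. rewrite sty_ren_as_sub. apply sty_sub_id. Qed.

Lemma rvcomp_shift_var P G V A W B :
  wf_maps P -> rvcomp P G V A W ->
  rvcomp P (env_var G B) (stm_ren id_ren id_ren S V) A (val_ren id_ren id_ren S W).
Proof.
  intros HP H. rewrite <- (sty_ren_id A). eapply rvcomp_ren; eauto.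
  split; [auto | split; [auto |]].
  intros n C Hn. rewrite sty_ren_id. exact Hn.
Qed.

Lemma rvcomp_shift_ty P G V A W :
  wf_maps P -> rvcomp P G V A W ->
  rvcomp P (env_ty G) (stm_ren id_ren S id_ren V) (sty_ren id_ren S A)
    (val_ren id_ren S id_ren W).
Proof.
  intros HP H. eapply rvcomp_ren; eauto.
  split; [auto | split; [simpl; intros; lia |]].
  intros n C Hn. simpl. rewrite nth_error_map.
  change (id_ren n) with n. rewrite Hn. reflexivity.
Qed.

Lemma rvcomp_shift_loc P G V A W :
  wf_maps P -> rvcomp P G V A W ->
  rvcomp P (env_loc G) (stm_ren S id_ren id_ren V) (sty_ren S id_ren A)
    (val_ren S id_ren id_ren W).
Proof.
  intros HP H. eapply rvcomp_ren; eauto.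
  split; [simpl; intros; lia | split; [auto |]].
  intros n C Hn. simpl. rewrite nth_error_map.
  change (id_ren n) with n. rewrite Hn. reflexivity.
Qed.

Definition typed_sub (P : fmaps) (G G' : env) (sl : nat -> loc) (st : nat -> sty)
    (sv : nat -> stm) (tv : nat -> val) : Prop :=
  (forall l, l < e_locs G -> loc_ok G' (sl l)) /\
  (forall n, n < e_tys G -> sty_ok G' (st n)) /\
  (forall n A, nth_error (e_vars G) n = Some A ->
     rvcomp P G' (sv n) (sty_sub sl st A) (tv n)).

(** [tv n] may be any run-time compilation of [sv n], so the values actually produced by the two
    evaluations can be substituted side by side. *)
Lemma rcomp_sub P :
  wf_maps P ->
  (forall G V A W, rvcomp P G V A W ->
     forall G' sl st sv tv, typed_sub P G G' sl st sv tv ->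
     rvcomp P G' (stm_sub sl st sv V) (sty_sub sl st A)
       (val_sub sl (fun n => vty (st n)) tv W)) /\
  (forall G L M A N, rcomp P G L M A N ->
     forall G' sl st sv tv, typed_sub P G G' sl st sv tv ->
     rcomp P G' (loc_sub sl L) (stm_sub sl st sv M) (sty_sub sl st A)
       (tm_sub sl (fun n => vty (st n)) tv N)).
Proof.
  intro HP. apply rcomp_traverse; auto.
  - intros G G' sl st sv tv A (Hl & Ht & Hv).
    split; [exact Hl | split; [exact Ht |]].
    intros [|n] B Hn; simpl in *.
    + injection Hn as ->. constructor. reflexivity.
    + apply rvcomp_shift_var; auto.
  - intros G G' sl st sv tv (Hl & Ht & Hv).
    split; [exact Hl | split; [apply up_sty_in, Ht |]].
    intros n B Hn. apply nth_error_map_some in Hn as (A & Hn & ->).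
    rewrite sty_sub_shift_ty. apply rvcomp_shift_ty; auto.
  - intros G G' sl st sv tv (Hl & Ht & Hv).
    split; [apply up_loc_in, Hl | split; [intros; apply shift_loc_sty_in, Ht; auto |]].
    intros n B Hn. apply nth_error_map_some in Hn as (A & Hn & ->).
    rewrite sty_sub_shift_loc. apply rvcomp_shift_loc; auto.
Qed.

(** * Forward simulation *)

(* The contexts in which compiled subterms run: the list is ordered from the
   outermost [do] inwards. *)
Definition do_ctx (E : elet) (Ns : list tm) : ectx :=
  fold_right (fun N E' => EDo E' N) (EIn E) Ns.
Definition in_dos (Ns : list tm) : tm -> tm := plug (do_ctx EHole Ns).

Lemma plug_do_ctx E Ns M : plug (do_ctx E Ns) M = in_dos Ns (plug_let E M).
Proof. induction Ns as [|N Ns IH]; simpl; [|rewrite IH]; reflexivity. Qed.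

Lemma in_dos_rcons Ns N M : in_dos (Ns ++ [N]) M = in_dos Ns (TVal (VDo M N)).
Proof.
  unfold in_dos. induction Ns as [|N' Ns IH]; simpl; [|rewrite IH]; reflexivity.
Qed.

(** The universal quantifiers make runs composable: the same run can be replayed below further
    [do]s, or at the callee's site with the caller's context waiting on a stack. Site, context and
    stacks must be restored at the end. *)
Definition reaches (P : fmaps) (a : site) (N N' : tm) : Prop :=
  forall Ns Dc Ds,
    steps P (config_at a (in_dos Ns N) Dc Ds) (config_at a (in_dos Ns N') Dc Ds).

Lemma reaches_refl P a N : reaches P a N N.
Proof. intros Ns Dc Ds. apply rt_refl. Qed.

Lemma reaches_trans P a N1 N2 N3 :
  reaches P a N1 N2 -> reaches P a N2 N3 -> reaches P a N1 N3.
Proof. intros H1 H2 Ns Dc Ds. eapply rt_trans; [apply H1 | apply H2]. Qed.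

Lemma reaches_lstep P a N N' : lstep (P a) N N' -> reaches P a N N'.
Proof. intros H Ns Dc Ds. apply rt_step, s_local, H. Qed.

Lemma reaches_let P a M M' N :
  lstep (P a) M M' -> reaches P a (TLet M N) (TLet M' N).
Proof.
  intros H Ns Dc Ds. apply rt_step.
  change (TLet M N) with (plug_let (ELet EHole N) M).
  change (TLet M' N) with (plug_let (ELet EHole N) M').
  rewrite <- !plug_do_ctx. apply s_local, H.
Qed.

Lemma reaches_do P a M W N :
  reaches P a M (TVal (VUnit W)) ->
  reaches P a (TVal (VDo M N)) (tm_sub LV TyVar (scons W VVar) N).
Proof.
  intro H. apply reaches_trans with (TVal (VDo (TVal (VUnit W)) N)).
  - intros Ns Dc Ds. rewrite <- !in_dos_rcons. apply H.
  - apply reaches_lstep. constructor.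
Qed.

(** A pending [gen] first steps to the [invoke] for the current site. In a remote call all pending
    [do]s are pushed as one frame, the callee runs with none of its own, and its [unit] pops the
    frame. *)
Lemma reaches_dispatched P a b V W X U :
  reaches P b (TApp V W) (TVal (VUnit U)) ->
  dispatched (LC a) (LC b) V W X ->
  reaches P a X (TVal (VUnit U)).
Proof.
  intros H HX.
  enough (HI : reaches P a (invoke (LC a) (LC b) V W) (TVal (VUnit U))).
  { destruct HX as [->| ->]; [exact HI|].
    apply reaches_trans with (2 := HI). intros Ns Dc Ds. apply rt_step, s_gen. }
  unfold invoke. destruct (loc_eq_dec (LC a) (LC b)) as [[= ->]|Hab]; [exact H|].
  destruct a, b; try congruence; intros Ns Dc Ds.
  - eapply rt_trans; [apply rt_step, s_req |].
    eapply rt_trans; [apply (H [] (do_ctx EHole Ns :: Dc) Ds) |].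
    apply rt_step, s_to_client.
  - eapply rt_trans; [apply rt_step, s_call |].
    eapply rt_trans; [apply (H [] Dc (do_ctx EHole Ns :: Ds)) |].
    apply rt_step, s_to_server.
Qed.

Lemma eval_svalue a V V' : eval a V V' -> svalue V -> V' = V.
Proof.
  induction 1; intro HV; inversion HV; subst; f_equal; auto.
Qed.

Lemma rvcomp_svalue P G V A W : rvcomp P G V A W -> svalue V.
Proof. induction 1; constructor; auto. Qed.

(** Pairs are the only values matched by a second clause, and the side condition of [rc_pair]
    excludes it. *)
Lemma rcomp_value_inv P G L V A N :
  rcomp P G L V A N -> svalue V ->
  exists W, N = TVal (VUnit W) /\ rvcomp P G V A W.
Proof.
  intros H HV. inversion H; subst; try (inversion HV; fail); eauto.
  contradiction.
Qed.

Lemma rvcomp_pick P i V1 V2 A1 A2 W1 W2 :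
  rvcomp P empty_env V1 A1 W1 -> rvcomp P empty_env V2 A2 W2 ->
  rvcomp P empty_env (pick i V1 V2) (pick i A1 A2) (pick i W1 W2).
Proof. destruct i; auto. Qed.

Lemma dispatched_sub_site sl st sv a b V W X :
  dispatched (LC a) (LC b) V W X ->
  dispatched (LC a) (LC b) (val_sub sl st sv V) (val_sub sl st sv W)
    (tm_sub sl st sv X).
Proof. apply (dispatched_sub sl st sv (LC a) (LC b)). Qed.

(** The witness is whatever value the target computes. Asking only that it be related to [V] lets
    the induction pass through application and instantiation, where [rcomp_sub] relates the
    instantiated bodies. *)
Lemma simulation P : wf_maps P ->
  forall a M V, eval a M V ->
  forall A N, rcomp P empty_env (LC a) M A N ->
  exists W, rvcomp P empty_env V A W /\ reaches P a N (TVal (VUnit W)).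
Proof.
  intros HP a M V HE. induction HE; intros T N0 HC.
  - apply rcomp_value_inv in HC as (W & -> & HW); [|constructor].
    eauto using reaches_refl.
  - apply rcomp_value_inv in HC as (W & -> & HW); [|constructor; auto].
    eauto using reaches_refl.
  - apply rcomp_value_inv in HC as (W & -> & HW); [|constructor; auto].
    eauto using reaches_refl.
  - inversion HC as [? ? ? ? ? HV|? ? L' ? ? A ? N1 N2 X H1 H2 HX| | | |]; subst;
      [inversion HV|].
    destruct (IHHE1 _ _ H1) as (F & HF & R1).
    destruct (IHHE2 _ _ H2) as (U & HU & R2).
    inversion HF as [|? ? ? ? ? Ws Fn Ls As Nb HL HA Hcode Hbody| | |]; subst.
    assert (HS : typed_sub P (env_var empty_env A) empty_env LV STVar
                   (scons W SVar) (scons U VVar)).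
    { split; [simpl; lia | split; [simpl; lia |]].
      intros [|[|n]] B Hn; simpl in *; [|discriminate|discriminate].
      injection Hn as ->. rewrite sty_sub_id. exact HU. }
    assert (Hb := proj2 (rcomp_sub P HP) _ _ _ _ _ Hbody _ _ _ _ _ HS).
    rewrite sty_sub_id in Hb.
    destruct (IHHE3 _ _ Hb) as (U' & HU' & R3).
    exists U'. split; [exact HU'|].
    eapply reaches_trans; [apply (reaches_do _ _ _ _ _ R1)|].
    (* The code of the argument was shifted past [f], so substituting the closure for [f] gives it
       back. *)
    simpl. rewrite tm_sub_scons_shift1.
    eapply reaches_trans; [apply (reaches_do _ _ _ _ _ R2)|].
    eapply reaches_dispatched with (b := b) (V := VClo Ws Fn Ls As) (W := U).
    + eapply reaches_trans; [apply reaches_lstep|exact R3].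
      (* The code is looked up at the function's own site [b], not at the caller's site. *)
      eapply ls_app. apply Hcode. reflexivity.
    (* The two [do] steps replace [VVar 1] by the closure and then [VVar 0] by the argument; both
       locations are already sites. *)
    + apply (dispatched_sub_site LV TyVar (up_val (scons (VClo Ws Fn Ls As) VVar))) in HX.
      apply (dispatched_sub_site LV TyVar (scons U VVar)) in HX.
      cbn [val_sub up_val scons] in HX.
      rewrite val_sub_scons_shift in HX. exact HX.
  - inversion HC as [? ? ? ? ? HV| |? ? ? A ? N1 HB H1| | |]; subst;
      [inversion HV|].
    destruct (IHHE _ _ H1) as (F & HF & R1).
    inversion HF as [| | |? ? ? W HW|]; subst.
    assert (HS : typed_sub P (env_ty empty_env) empty_env LV (scons B STVar)
                   SVar VVar).
    { split; [simpl; lia | split].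
      - intros [|n] Hn; simpl in *; [exact HB | lia].
      - intros [|n] C Hn; discriminate. }
    eexists. split; [apply (proj1 (rcomp_sub P HP) _ _ _ _ HW _ _ _ _ _ HS)|].
    eapply reaches_trans; [apply (reaches_do _ _ _ _ _ R1)|].
    simpl. rewrite tty_sub_id.
    replace (fun n => vty (scons B STVar n)) with (scons (vty B) TyVar)
      by funext.
    (* The abstraction's body is already a [unit], so a single step ends the run. *)
    apply reaches_lstep. apply (ls_tapp _ (VUnit W)).
  - inversion HC as [? ? ? ? ? HV| | |? ? ? ? A N1 HL' H1| |]; subst;
      [inversion HV|].
    destruct (IHHE _ _ H1) as (F & HF & R1).
    inversion HF as [| |? ? ? Ws Fn Ls As W Hcode HW| |]; subst.
    assert (HS : typed_sub P (env_loc empty_env) empty_env (scons (LC b) LV) STVar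
                   SVar VVar).
    { split; [|split; [simpl; lia |]].
      - intros [|n] Hn; simpl in *; [exact I | lia].
      - intros [|n] C Hn; discriminate. }
    eexists. split; [apply (proj1 (rcomp_sub P HP) _ _ _ _ HW _ _ _ _ _ HS)|].
    eapply reaches_trans; [apply (reaches_do _ _ _ _ _ R1)|].
    (* A location abstraction is opened where it is applied, at [a]; its code is present at every
       site. *)
    apply reaches_lstep. apply (ls_lapp _ _ _ _ _ _ b _ (Hcode a)).
  - inversion HC as [? ? ? ? ? HV| | | |? ? ? ? A1 A2 N1 N2 Hnv H1 H2|]; subst.
    (* A pair of values was compiled directly to a [unit]; evaluation leaves it unchanged and the
       target takes no step. *)
    + assert (Hs := rvcomp_svalue _ _ _ _ _ HV). inversion Hs; subst.
      rewrite (eval_svalue _ _ _ HE1), (eval_svalue _ _ _ HE2) by assumption.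
      eauto using reaches_refl.
    + destruct (IHHE1 _ _ H1) as (W1 & HW1 & R1).
      destruct (IHHE2 _ _ H2) as (W2 & HW2 & R2).
      exists (VPair W1 W2). split; [constructor; auto|].
      eapply reaches_trans; [apply (reaches_do _ _ _ _ _ R1)|].
      simpl. rewrite tm_sub_scons_shift1.
      eapply reaches_trans; [apply (reaches_do _ _ _ _ _ R2)|].
      simpl. rewrite val_sub_scons_shift. apply reaches_refl.
  - inversion HC as [? ? ? ? ? HV| | | | |? ? ? ? A1 A2 N1 H1]; subst;
      [inversion HV|].
    destruct (IHHE _ _ H1) as (F & HF & R1).
    inversion HF as [| | | |? ? ? ? ? W1 W2 HW1 HW2]; subst.
    exists (pick i W1 W2). split; [apply rvcomp_pick; auto|].
    eapply reaches_trans; [apply (reaches_do _ _ _ _ _ R1)|].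
    simpl. eapply reaches_trans; [apply reaches_let, ls_proj|].
    apply reaches_lstep. apply (ls_let _ (pick i W1 W2) (TVal (VUnit (VVar 0)))).
Qed.

(** * Comparison with a fresh compilation *)

Scheme val_eqv_mut := Minimality for val_eqv Sort Prop
with tm_eqv_mut := Minimality for tm_eqv Sort Prop.
Combined Scheme eqv_mutind from val_eqv_mut, tm_eqv_mut.

Lemma closure_code_incl Phi Phi' Ws F Ls As T O :
  incl Phi Phi' ->
  closure_code Phi Ws F Ls As T O -> closure_code Phi' Ws F Ls As T O.
Proof. intros H (CT & K & Hin & HK). exists CT, K. auto. Qed.

(** Equivalence consults the maps positively and only at closures. Growth is wanted on the right
    alone, where recompilation adds bindings while the running program's maps stay fixed. *)
Lemma eqv_mono P Q Q' :
  sub_maps Q Q' ->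
  (forall L V V', val_eqv P Q L V V' -> val_eqv P Q' L V V') /\
  (forall L M M', tm_eqv P Q L M M' -> tm_eqv P Q' L M M').
Proof.
  intro HQ. apply eqv_mutind; intros; try (constructor; auto; fail).
  - eapply ve_lam; eauto using closure_code_incl.
  - eapply ve_llam; eauto using closure_code_incl.
Qed.

Lemma tm_sub_invoke st sv L L0 V W :
  tm_sub LV st sv (invoke L L0 V W)
  = invoke L L0 (val_sub LV st sv V) (val_sub LV st sv W).
Proof.
  unfold invoke. destruct loc_eq_dec; [reflexivity|].
  destruct L as [[|]|], L0 as [[|]|]; reflexivity.
Qed.

(** Serves the [shift1] in the code of applications and pairs. Renamings are written as
    substitutions so that [closure_code_sub] applies, and locations stay fixed so that [invoke]
    keeps its form. *)
Lemma eqv_ren P Q :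
  wf_maps P -> wf_maps Q ->
  (forall L V V', val_eqv P Q L V V' -> forall r,
     val_eqv P Q L (val_sub LV TyVar (fun n => VVar (r n)) V)
       (val_sub LV TyVar (fun n => VVar (r n)) V')) /\
  (forall L M M', tm_eqv P Q L M M' -> forall r,
     tm_eqv P Q L (tm_sub LV TyVar (fun n => VVar (r n)) M)
       (tm_sub LV TyVar (fun n => VVar (r n)) M')).
Proof.
  intros HP HQ. apply eqv_mutind; intros; simpl;
    rewrite ?up_val_var, ?up_tty_id, ?tty_sub_id, ?loc_sub_id;
    try (constructor; auto; fail).
  - eapply ve_lam with (A := A) (B := B) (L0 := L0).
    + intros a Ha.
      assert (E := closure_code_sub _ _ _ _ _ _ _ _ LV TyVar
                     (fun n => VVar (r n)) HP (H a Ha)).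
      rewrite tty_sub_id in E. simpl in E. exact E.
    + intros a Ha.
      assert (E := closure_code_sub _ _ _ _ _ _ _ _ LV TyVar
                     (fun n => VVar (r n)) HQ (H0 a Ha)).
      rewrite tty_sub_id in E. simpl in E. exact E.
    + rewrite up_val_var. apply H2.
  - eapply ve_llam with (A := A).
    + intros a.
      assert (E := closure_code_sub _ _ _ _ _ _ _ _ LV TyVar
                     (fun n => VVar (r n)) HP (H a)).
      rewrite tty_sub_id in E. simpl in E. exact E.
    + intros a.
      assert (E := closure_code_sub _ _ _ _ _ _ _ _ LV TyVar
                     (fun n => VVar (r n)) HQ (H0 a)).
      rewrite tty_sub_id in E. simpl in E. exact E.
    + rewrite up_loc_id. intro L0. apply H2.
  - rewrite tm_sub_invoke. constructor; auto.
Qed.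

Lemma tm_eqv_shift1 P Q L M M' :
  wf_maps P -> wf_maps Q -> tm_eqv P Q L M M' ->
  tm_eqv P Q L (shift1 M) (shift1 M').
Proof.
  intros HP HQ H. unfold shift1. rewrite !tm_ren_as_sub.
  apply (proj2 (eqv_ren P Q HP HQ)), H.
Qed.

(** A call already in its final form coincides with the fresh one; a leftover [gen] is matched
    through [te_dispatch]. *)
Lemma dispatched_eqv P Q L L' V W X :
  dispatched L L' V W X ->
  val_eqv P Q L V V -> val_eqv P Q L W W -> tm_eqv P Q L X (invoke L L' V W).
Proof.
  intros [->| ->] HV HW; [|constructor; auto].
  unfold invoke. destruct loc_eq_dec; [constructor; auto|].
  destruct L as [[|]|], L' as [[|]|]; repeat constructor; auto.
Qed.

(** * Supplies of fresh function names *)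

Definition names_within (k k' : nat) (Q : fmaps) : Prop :=
  forall a F, In F (map fst (Q a)) -> k <= F < k'.

Lemma names_within_fresh k k' Q : names_within k k' Q -> fresh k' Q.
Proof. intros H a Hin. apply H in Hin. lia. Qed.

Lemma names_within_disjoint k k' k'' Q Q' :
  names_within k k' Q -> names_within k' k'' Q' -> disjoint Q Q'.
Proof.
  intros H H' F. destruct (le_lt_dec k' F).
  - left. intros a Hin. apply H in Hin. lia.
  - right. intros a Hin. apply H' in Hin. lia.
Qed.

Lemma names_within_join k k' k'' Q Q' :
  k <= k' -> k' <= k'' ->
  names_within k k' Q -> names_within k' k'' Q' ->
  names_within k k'' (join Q Q').
Proof.
  intros Hk Hk' H H' a F Hin. unfold join in Hin. rewrite map_app in Hin.
  apply in_app_or in Hin as [Hin|Hin]; [apply H in Hin | apply H' in Hin]; lia.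
Qed.

Lemma names_within_add_code k k' L CT K Q :
  k <= k' -> names_within k k' Q -> names_within k (S k') (add_code L k' CT K Q).
Proof.
  intros Hk H a F Hin. unfold add_code in Hin.
  destruct (hosted_dec L a); simpl in Hin; [destruct Hin as [<-|Hin]; [lia|]|];
    apply H in Hin; lia.
Qed.

Lemma names_within_add_code_both k k' CT K Q :
  k <= k' -> names_within k k' Q ->
  names_within k (S k') (add_code_both k' CT K Q).
Proof.
  intros Hk H a F Hin. simpl in Hin. destruct Hin as [<-|Hin]; [lia|].
  apply H in Hin. lia.
Qed.

Lemma sub_maps_refl P : sub_maps P P.
Proof. intros a x Hx. exact Hx. Qed.

(** The run-time relation retains all the typing data that the compiler asks for, so its derivation
    can be compiled again, with [k] as a counter of names. For values one [W'] and one [Q] must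
    serve all locations, because the body of a polymorphic value is compared at every location. *)
Lemma rcomp_recompile P : wf_maps P ->
  (forall G V A W, rvcomp P G V A W -> env_ok G -> forall k,
     exists k' W' Q, k <= k' /\ names_within k k' Q /\
       (forall L, vcomp G L V A W' Q) /\ forall L, val_eqv P Q L W W') /\
  (forall G L M A N, rcomp P G L M A N -> env_ok G -> forall k,
     exists k' N' Q, k <= k' /\ names_within k k' Q /\
       ccomp G L M A N' Q /\ tm_eqv P Q L N N').
Proof.
  intro HP. apply rcomp_mutind.
  - intros G n A Hn _ k. exists k, (VVar n), no_code.
    split; [lia|]. split; [intros a F []|]. split; intro; constructor; auto.
  - intros G L' M A B Ws F Ls As N HL HA HC _ IH HG k.
    assert (HG' := env_ok_var _ _ HG HA).
    destruct (IH HG' k) as (k' & N' & Q & Hk & HQ & HN' & HE).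
    set (Q' := add_code L' k' (env_codety G (TyArr (vty A) L' (cty B)))
                 (env_code G (OLam N')) Q).
    destruct (sub_maps_add_code _ _ _ _ _ _ (sub_maps_refl Q')) as [Hsub Hin].
    destruct (proj2 comp_scoped _ _ _ _ _ _ HN' HG') as (HS & HB & _).
    exists (S k'), (env_closure G k'), Q'. split; [lia|].
    split; [apply names_within_add_code; auto|]. split.
    + intro L. constructor; eauto using names_within_fresh.
    + intro L. eapply ve_lam with (M := N) (M' := N').
      * exact HC.
      * intros a Ha. apply env_closure_code; auto.
        -- apply arr_scoped; auto.
        -- apply lam_scoped, HS.
      (* The bodies were compared before the enclosing function was added to the maps. *)
      * apply (proj2 (eqv_mono P Q Q' Hsub)), HE.
  - intros G V A Ws F Ls As W HC _ IH HG k.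
    assert (HG' := env_ok_loc _ HG).
    destruct (IH HG' k) as (k' & W' & Q & Hk & HQ & HW' & HE).
    set (Q' := add_code_both k' (env_codety G (TyAllL (cty A)))
                 (env_code G (OLLam (VUnit W'))) Q).
    destruct (sub_maps_add_code_both _ _ _ _ _ (sub_maps_refl Q')) as [Hsub Hin].
    (* The location is arbitrary: scoping does not mention it. *)
    destruct (proj1 comp_scoped _ _ _ _ _ _ (HW' (LC client)) HG') as (HS & HA & _).
    exists (S k'), (env_closure G k'), Q'. split; [lia|].
    split; [apply names_within_add_code_both; auto|]. split.
    + intro L. constructor; eauto using names_within_fresh.
    + intro L. eapply ve_llam with (V := VUnit W) (V' := VUnit W').
      * exact HC.
      * intros a. apply env_closure_code; auto.
        -- apply all_loc_scoped; auto.
        -- apply unit_llam_scoped, HS.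
      * intro L0. constructor. apply (proj1 (eqv_mono P Q Q' Hsub)), HE.
  - intros G V A W _ IH HG k.
    destruct (IH (env_ok_ty _ HG) k) as (k' & W' & Q & Hk & HQ & HW' & HE).
    exists k', (VTLam (VUnit W')), Q. split; [lia|]. split; [exact HQ|].
    split; intro L; constructor; auto. intro L0. constructor. apply HE.
  - intros G V1 V2 A1 A2 W1 W2 _ IH1 _ IH2 HG k.
    destruct (IH1 HG k) as (k1 & W1' & Q1 & Hk1 & HQ1 & HW1 & HE1).
    (* Starting at [k1], where the first component stopped, makes the two sets of names disjoint. *)
    destruct (IH2 HG k1) as (k2 & W2' & Q2 & Hk2 & HQ2 & HW2 & HE2).
    assert (Hs := sub_maps_refl (join Q1 Q2)).
    exists k2, (VPair W1' W2'), (join Q1 Q2). split; [lia|].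
    split; [eauto using names_within_join|].
    split; intro L; constructor; eauto using names_within_disjoint.
    + apply (proj1 (eqv_mono P Q1 _ (sub_maps_join_l _ _ _ Hs))), HE1.
    + apply (proj1 (eqv_mono P Q2 _ (sub_maps_join_r _ _ _ Hs))), HE2.
  - intros G L V A W _ IH HG k.
    destruct (IH HG k) as (k' & W' & Q & Hk & HQ & HW' & HE).
    exists k', (TVal (VUnit W')), Q.
    split; [lia|]. split; [exact HQ|]. split; repeat constructor; auto.
  - intros G L L' M1 M2 A B N1 N2 X _ IH1 _ IH2 HX HG k.
    destruct (IH1 HG k) as (k1 & N1' & Q1 & Hk1 & HQ1 & HN1 & HE1).
    destruct (IH2 HG k1) as (k2 & N2' & Q2 & Hk2 & HQ2 & HN2 & HE2).
    assert (Hs := sub_maps_refl (join Q1 Q2)).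
    destruct (proj2 comp_scoped _ _ _ _ _ _ HN2 HG) as (_ & _ & HwQ2).
    exists k2. eexists. exists (join Q1 Q2). split; [lia|].
    split; [eauto using names_within_join|].
    split; [eapply c_app; eauto using names_within_disjoint|].
    do 2 constructor; [|do 2 constructor].
    + apply (proj2 (eqv_mono P Q1 _ (sub_maps_join_l _ _ _ Hs))), HE1.
    + apply (proj2 (eqv_mono P Q2 _ (sub_maps_join_r _ _ _ Hs))).
      apply tm_eqv_shift1; auto.
    + apply dispatched_eqv; auto; constructor.
  - intros G L M A B N HB _ IH HG k.
    destruct (IH HG k) as (k' & N' & Q & Hk & HQ & HN' & HE).
    exists k'. eexists. exists Q. split; [lia|]. split; [exact HQ|].
    split; [apply c_tapp; eauto|]. repeat constructor; auto.
  - intros G L L' M A N HL' _ IH HG k.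
    destruct (IH HG k) as (k' & N' & Q & Hk & HQ & HN' & HE).
    exists k'. eexists. exists Q. split; [lia|]. split; [exact HQ|].
    split; [apply c_lapp; eauto|]. repeat constructor; auto.
  - intros G L M1 M2 A1 A2 N1 N2 Hnv _ IH1 _ IH2 HG k.
    destruct (IH1 HG k) as (k1 & N1' & Q1 & Hk1 & HQ1 & HN1 & HE1).
    destruct (IH2 HG k1) as (k2 & N2' & Q2 & Hk2 & HQ2 & HN2 & HE2).
    assert (Hs := sub_maps_refl (join Q1 Q2)).
    destruct (proj2 comp_scoped _ _ _ _ _ _ HN2 HG) as (_ & _ & HwQ2).
    exists k2. eexists. exists (join Q1 Q2). split; [lia|].
    split; [eauto using names_within_join|].
    split; [apply c_pair; eauto using names_within_disjoint|].
    do 2 constructor; [|do 2 constructor].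
    + apply (proj2 (eqv_mono P Q1 _ (sub_maps_join_l _ _ _ Hs))), HE1.
    + apply (proj2 (eqv_mono P Q2 _ (sub_maps_join_r _ _ _ Hs))).
      apply tm_eqv_shift1; auto.
    + repeat constructor.
  - intros G L i M A1 A2 N _ IH HG k.
    destruct (IH HG k) as (k' & N' & Q & Hk & HQ & HN' & HE).
    exists k'. eexists. exists Q. split; [lia|]. split; [exact HQ|].
    split; [eapply c_proj; eauto|]. repeat constructor; auto.
Qed.

Theorem theorem4p3 (M V : stm) (A : sty) (N : tm) (P : fmaps)
  (HM : typing empty_env (LC client) M A)
  (HC : ccomp empty_env (LC client) M A N P)
  (HE : eval client M V) :
  exists (N' : tm) (Q : fmaps),
    ccomp empty_env (LC client) V A N' Q /\
    exists R : tm,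
      steps P (OnClient N [] []) (OnClient R [] []) /\
      tm_eqv P Q (LC client) R N'.
Proof.
  assert (HG : env_ok empty_env) by constructor.
  destruct (proj2 comp_scoped _ _ _ _ _ _ HC HG) as (_ & _ & HP).
  assert (HR := proj2 (comp_rcomp P) _ _ _ _ _ _ HC HG (sub_maps_refl P)).
  destruct (simulation P HP _ _ _ HE _ _ HR) as (W & HW & Hsteps).
  (* The counter may start at 0 even if [P] uses the same names: [Q] is a separate pair of maps and
     is never joined with [P]. *)
  destruct (proj1 (rcomp_recompile P HP) _ _ _ _ HW HG 0)
    as (_ & W' & Q & _ & _ & HW' & HE').
  exists (TVal (VUnit W')), Q. split; [constructor; auto|].
  exists (TVal (VUnit W)). split.
  (* With no pending [do]s and empty stacks, [reaches] is the required reduction on the client. *)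
  - exact (Hsteps [] [] []).
  - repeat constructor. apply HE'.
Qed.
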